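(* Suppose that the Cauchy problem $$u''(t)+\left(\alpha+\beta\|A^{1/2}u(t)\|^2\right)Au(t)+a_1Bv(t)=f_1(t),\qquad v''(t)+\gamma Av(t)+\delta Cv(t)+a_2Bu(t)=f_2(t),\quad t\in[0,T],$$ $$u(0)=\varphi_0,\quad u'(0)=\varphi_1,\quad v(0)=\psi_0,\quad v'(0)=\psi_1$$ in the real Hilbert space $\mathcal H$ is well-posed, let $(u,v)$ be its solution, and suppose that: (a) $\varphi_0,\psi_0\in D(A)$, and $\varphi_1,\psi_1,\varphi_2,\psi_2\in D(A^{1/2})$; $f_1(t)$ and $f_2(t)$ are continuous functions; moreover $f_1(t),f_2(t)\in D(A^{1/2})$ for all $t\in[0,T]$, and $A^{1/2}f_1(t)$ and $A^{1/2}f_2(t)$ are also continuous functions. (b) The solutions $u(t)$ and $v(t)$ are continuously differentiable up to and including third order, and $u'''(t)$ and $v'''(t)$ satisfy the Lipschitz condition. (c) $Au(t)$ and $Av(t)$ are continuously differentiable; moreover $Au'(t)$ and $Av'(t)$ are Lipschitz continuous functions. Let $u_k,v_k$ be the approximations produced by the three-layer semi-discrete scheme with step $\tau=T/n$ described in the context. Then there exists $\overline T$ with $0<\overline T\le T$ such that the errors $z_{1,k}=u(t_k)-u_k$ and $z_{2,k}=v(t_k)-v_k$ satisfy $$\max_{1\le k\le m}\|A^{1/2}z_{j,k}\|\le c_j\,\tau^2,\qquad \max_{1\le k\le m}\left\|\frac{\Delta z_{j,k-1}}{\tau}\right\|\le c_j'\,\tau^2,\qquad j=1,2,$$ where $m=[\overline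 T/\tau]$, $\Delta z_{j,k}=z_{j,k+1}-z_{j,k}$, and $c_j,c_j'$ are positive constants independent of $\tau$ (equivalently, of $n$).
   Context: $\mathcal H$ is a real Hilbert space with inner product $(\cdot,\cdot)$ and norm $\|\cdot\|$. $\alpha,\beta,\gamma,\delta$ are positive constants and $a_1,a_2$ are real constants of arbitrary sign. $A$ is a self-adjoint, positive-definite (generally unbounded) operator, independent of $t$, with dense domain $D(A)$: $A=A^*\ge\nu I$, $\nu>0$. $C$ is a symmetric bounded operator on $\mathcal H$ with $(C\varphi,\varphi)\ge0$ for all $\varphi\in\mathcal H$. $B$ is a closed linear operator with $D(A)\subset D(B)$ and $\|B\varphi\|^2\le c_B^2(A\varphi,\varphi)$ for all $\varphi\in D(A)$, for some constant $c_B>0$. $f_1,f_2:[0,T]\to\mathcal H$ are given continuous functions and $\varphi_0,\varphi_1,\psi_0,\psi_1\in\mathcal H$ are given. Solution: a pair of functions $u,v:[0,T]\to\mathcal H$ that are twice continuously differentiable, with $u(t),v(t)\in D(A)$ for every $t$, $Au$ and $Av$ continuous, satisfying the two equations on $[0,T]$ and the initial conditions. Scheme: let $n>1$ be an integer, $\tau=T/n$, $t_k=k\tau$, $L=\gamma A+\delta C$, $f_{i,k}=f_i(t_k)$, $\Delta u_{k-1}=u_k-u_{k-1}$, $\Delta^2u_{k-1}=\Delta(\Delta u_{k-1})=u_{k+1}-2u_k+u_{k-1}$. The starting vectors are $$u_0=\varphi_0,\quad u_1=\varphi_0+\tau\varphi_1+\tfrac{\tau^2}{2}\varphi_2,\quad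 \varphi_2=f_{1,0}-a_1B\psi_0-\left(\alpha+\beta\|A^{1/2}\varphi_0\|^2\right)A\varphi_0,$$ $$v_0=\psi_0,\quad v_1=\psi_0+\tau\psi_1+\tfrac{\tau^2}{2}\psi_2,\quad \psi_2=f_{2,0}-a_2B\varphi_0-L\psi_0,$$ and for $k=1,\dots,n-1$ the vectors $u_{k+1},v_{k+1}$ are determined (uniquely) by $$\frac{\Delta^2u_{k-1}}{\tau^2}+\left(\alpha+\beta\|A^{1/2}u_k\|^2\right)\frac{Au_{k+1}+Au_{k-1}}{2}=f_{1,k}-a_1Bv_k,$$ $$\frac{\Delta^2v_{k-1}}{\tau^2}+\frac{Lv_{k+1}+Lv_{k-1}}{2}=f_{2,k}-a_2Bu_k.$$ $[\cdot]$ denotes the integer part. *)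

(* Defs.v *)
From HB Require Import structures.
From mathcomp Require Import all_boot all_order all_algebra.
From mathcomp Require Import sesquilinear.
From mathcomp Require Import all_classical all_reals all_analysis.

Set Implicit Arguments.
Unset Strict Implicit.
Unset Printing Implicit Defensive.

Import Order.TTheory GRing.Theory Num.Theory.
Import numFieldNormedType.Exports.

Local Open Scope classical_set_scope.
Local Open Scope ring_scope.

(* A real Hilbert space is a complete normed space [H] with an inner product
   [ip] inducing its norm. *)
Definition induces_norm (R : realType) (H : completeNormedModType R)
    (ip : {dot H for (@idfun R)}) : Prop :=
  forall x : H, `|x| ^+ 2 = ip x x.

(* A possibly unbounded linear operator: [opfun] is linear on the subspace
   [dom]; its values outside [dom] are arbitrary. *)
Record unbounded_operator (R : realType) (H : completeNormedModType R) :=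
  UnboundedOperator {
    dom : set H;
    opfun :> H -> H;
    dom0 : dom 0;
    dom_lin : forall (a : R) x y, dom x -> dom y -> dom (a *: x + y);
    opfun_lin : forall (a : R) x y, dom x -> dom y ->
      opfun (a *: x + y) = a *: opfun x + opfun y }.

Section operators.
Context (R : realType) (H : completeNormedModType R).
Implicit Types (ip : {dot H for (@idfun R)}) (A S B : unbounded_operator H).

(* (y, z) belongs to the graph of the adjoint of A. *)
Definition adjoint_graph ip A (y z : H) : Prop :=
  forall x, dom A x -> ip (A x) y = ip x z.

Definition self_adjoint ip A : Prop :=
  dense (dom A) /\
  forall y z, (dom A y /\ A y = z) <-> adjoint_graph ip A y z.

Definition bounded_below_by ip (nu : R) A : Prop :=
  forall x, dom A x -> nu * ip x x <= ip (A x) x.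

(* S = A^{1/2}: S is self-adjoint and nonnegative, and S^2 = A, domains
   included; these properties determine (dom S, S on dom S) uniquely. *)
Definition is_sqrt_op ip A S : Prop :=
  [/\ self_adjoint ip S,
      bounded_below_by ip 0 S,
      forall x, dom A x <-> dom S x /\ dom S (S x) &
      forall x, dom A x -> A x = S (S x)].

Definition closed_operator B : Prop :=
  closed [set p : H * H | dom B p.1 /\ p.2 = B p.1].

Definition bounded_operator (C : {linear H -> H}) : Prop :=
  exists M : R, forall x : H, `|C x| <= M * `|x|.

Definition symmetric_operator ip (C : {linear H -> H}) : Prop :=
  forall x y : H, ip (C x) y = ip x (C y).

End operators.

Section calculus_within.
Context (R : realType) (H : completeNormedModType R) (I : set R).
Implicit Types (w : R -> H) (t : R).

(* Derivatives are taken relative to I, hence are one-sided at the endpoints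
   of a closed interval; only the values of w on I matter. *)
Definition diff_quotient w t : R -> H := fun s => (s - t)^-1 *: (w s - w t).

Definition derivable_within w : Prop :=
  forall t, I t -> cvg (diff_quotient w t @ within I t^').

Definition deriv_within w : R -> H :=
  fun t => lim (diff_quotient w t @ within I t^').

Definition nderiv_within (n : nat) w : R -> H := iter n deriv_within w.

Definition continuously_derivable_within (n : nat) w : Prop :=
  (forall k, (k < n)%N -> derivable_within (nderiv_within k w)) /\
  (forall k, (k <= n)%N -> {within I, continuous (nderiv_within k w)}).

End calculus_within.

Section cauchy_problem.
Context (R : realType) (H : completeNormedModType R).
Variables (T alpha beta gamma delta a1 a2 : R).
Variables (A S B : unbounded_operator H) (C : {linear H -> H}).
Variables (f1 f2 : R -> H) (phi0 phi1 psi0 psi1 : H).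

Definition kirchhoff_coef (x : H) : R := alpha + beta * `|S x| ^+ 2.

(* L = gamma A + delta C, with domain D(A). *)
Definition Lop (x : H) : H := gamma *: A x + delta *: C x.

Local Notation I := (`[0, T]%classic : set R).
Local Notation D := (deriv_within I).

Definition is_solution (u v : R -> H) : Prop :=
  [/\ continuously_derivable_within I 2 u /\
      continuously_derivable_within I 2 v,
      forall t, I t -> dom A (u t) /\ dom A (v t),
      {within I, continuous (fun t => A (u t))} /\
      {within I, continuous (fun t => A (v t))},
      forall t, I t ->
        D (D u) t + kirchhoff_coef (u t) *: A (u t) + a1 *: B (v t) = f1 t /\
        D (D v) t + gamma *: A (v t) + delta *: C (v t) + a2 *: B (u t)
          = f2 t &
      [/\ u 0 = phi0, D u 0 = phi1, v 0 = psi0 & D v 0 = psi1]].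

(* Existence and uniqueness; no continuous dependence on the data is asked
   for. *)
Definition well_posed : Prop :=
  (exists u v, is_solution u v) /\
  forall u v u' v', is_solution u v -> is_solution u' v' ->
    forall t, I t -> u t = u' t /\ v t = v' t.

Definition phi2 : H := f1 0 - a1 *: B psi0 - kirchhoff_coef phi0 *: A phi0.

Definition psi2 : H := f2 0 - a2 *: B phi0 - Lop psi0.

Definition fdiff (w : nat -> H) : nat -> H := fun k => w k.+1 - w k.

(* (uh k, vh k), k = 0, ..., n, is produced by the scheme with step tau = T/n.
   For k = 2 the equations involve A (uh 1) and A (vh 1).  Although phi1, phi2,
   psi1, psi2 are only assumed to lie in D(A^{1/2}), the regularity
   of the solution puts them in D(A): phi1 = u'(0), and phi2 = u''(0) is the
   derivative at 0 of u' while A u' is Lipschitz, so that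
   |(A w, phi2)| <= K |w| on D(A) and phi2 is in D(A^* ) = D(A); likewise for
   psi1, psi2.  Hence uh 1 and vh 1 are in D(A), and this need not be
   required here. *)
Definition is_scheme (n : nat) (uh vh : nat -> H) : Prop :=
  let tau : R := T / n%:R in
  let t (k : nat) : R := k%:R * tau in
  [/\ uh 0 = phi0 /\ vh 0 = psi0,
      uh 1 = phi0 + tau *: phi1 + (tau ^+ 2 / 2) *: phi2,
      vh 1 = psi0 + tau *: psi1 + (tau ^+ 2 / 2) *: psi2 &
      forall k, (1 <= k < n)%N ->
        [/\ dom A (uh k.+1), dom A (vh k.+1),
            (tau ^+ 2)^-1 *: fdiff (fdiff uh) k.-1
              + kirchhoff_coef (uh k)
                *: (2^-1 *: (A (uh k.+1) + A (uh k.-1)))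
              = f1 (t k) - a1 *: B (vh k) &
            (tau ^+ 2)^-1 *: fdiff (fdiff vh) k.-1
              + 2^-1 *: (Lop (vh k.+1) + Lop (vh k.-1))
              = f2 (t k) - a2 *: B (uh k)]].

End cauchy_problem.

(* Main.v *)
Require Import Defs.
From HB Require Import structures.
From mathcomp Require Import all_boot all_order all_algebra.
From mathcomp Require Import sesquilinear.
From mathcomp Require Import all_classical all_reals all_analysis.
From mathcomp Require Import ring lra.

(** Consistency and stability are both of second order in the energy norm, and
    the only real difficulty is that stability depends on the discrete solution
    itself, through the coefficient q_k = alpha + beta |A^{1/2} u_k|^2.

    Stability.  Pair the difference of the exact and the discrete equation with
    z_{k+1} - z_{k-1}, where z is the error ([three_layer_energy_le]).  The
    symmetric average of A z_{k+1} and A z_{k-1} makes the operator term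
    telescope, so that the energy
      |dz_k / tau|^2 + (q_k / 2) (|A^{1/2} z_{k+1}|^2 + |A^{1/2} z_k|^2),
    added to its counterpart for the second equation, grows by at most a factor
    1 + O(tau), up to the squared defect, provided that q_k - q_{k-1} = O(tau)
    ([energy_step_le]).  The coupling through B costs nothing more, because
    |B x| <= cB |A^{1/2} x|.

    Closing the loop.  If the energy at step k is O(tau^4), then
    |A^{1/2} z_k| = O(tau^2) <= tau for small tau, and q_k is within O(tau) of
    the Lipschitz function alpha + beta |A^{1/2} u(t)|^2; hence
    q_{k+1} - q_k = O(tau) and the energy estimate applies once more.
    Restricting time to a short interval [0, Tbar] makes the accumulated growth
    at most one unit of tau^4 ([bootstrap_induction]), so a plain induction
    replaces a discrete Gronwall inequality.  The same choice disposes of large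
    steps: when tau > Tbar no index k satisfies 1 <= k <= Tbar / tau, so only
    small tau matter ([regular_scheme_convergence]).

    Consistency.  Taylor's formula with a Lipschitz top derivative
    ([taylor_remainder_le]) makes the second difference quotient of u and the
    symmetric averages of A u and C v accurate to order tau^2.

    The first step.  The error z_1 is O(tau^3) in norm, and
    |A^{1/2} z_1|^2 <= |A z_1| |z_1| = O(tau^5), once u_1 is known to be in
    D(A).  For this, u''(0) must be in D(A): since A u' is Lipschitz, the
    functional w |-> (A w, u''(0)) is bounded on D(A), hence is represented by a
    vector ([riesz_on_domain]), and A is self-adjoint
    ([dom_deriv_of_lipschitz]). *)

Set Implicit Arguments.
Unset Strict Implicit.
Unset Printing Implicit Defensive.

Import Order.TTheory GRing.Theory Num.Theory.
Import numFieldNormedType.Exports.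

Local Open Scope classical_set_scope.
Local Open Scope ring_scope.

(** * Inner products *)
Section inner_product.
Context (R : realType) (H : completeNormedModType R) (ip : {dot H for (@idfun R)}).

Lemma ipC (x y : H) : ip x y = ip y x.
Proof. by rewrite hermC expr0 mul1r. Qed.

Lemma ipDl (x y z : H) : ip (x + y) z = ip x z + ip y z.
Proof. exact: linearDl. Qed.

Lemma ipBl (x y z : H) : ip (x - y) z = ip x z - ip y z.
Proof. exact: linearBl. Qed.

Lemma ipZl (a : R) (x z : H) : ip (a *: x) z = a * ip x z.
Proof. exact: linearZl_LR. Qed.

Lemma ip0l (z : H) : ip 0 z = 0.
Proof. exact: linear0l. Qed.

Lemma ipDr (x y z : H) : ip z (x + y) = ip z x + ip z y.
Proof. by rewrite ipC ipDl !(ipC z). Qed.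

Lemma ipBr (x y z : H) : ip z (x - y) = ip z x - ip z y.
Proof. by rewrite ipC ipBl !(ipC z). Qed.

Lemma ipZr (a : R) (x z : H) : ip z (a *: x) = a * ip z x.
Proof. by rewrite ipC ipZl (ipC z). Qed.

Context (ip_norm : induces_norm ip).

(** Cauchy-Schwarz: expand the square of | |y| x - |x| y |, which is nonnegative. *)
Lemma ip_le_norm (x y : H) : ip x y <= `|x| * `|y|.
Proof.
have [->|x0] := eqVneq x 0; first by rewrite ip0l normr0 mul0r.
have [->|y0] := eqVneq y 0; first by rewrite ipC ip0l normr0 mulr0.
have nx : 0 < `|x| by rewrite normr_gt0.
have ny : 0 < `|y| by rewrite normr_gt0.
have : 0 <= `| `|y| *: x - `|x| *: y | ^+ 2 by rewrite exprn_ge0.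
rewrite ip_norm ipBl !ipBr !ipZl !ipZr -!ip_norm (ipC y x) => h.
have {}h : 0 <= 2 * (`|x| * `|y|) * (`|x| * `|y| - ip x y) by nra.
by move: h; rewrite pmulr_rge0 ?subr_ge0// mulr_gt0// mulr_gt0.
Qed.

Lemma ler_norm_ip (x y : H) : `|ip x y| <= `|x| * `|y|.
Proof.
rewrite ler_norml ip_le_norm andbT lerNl.
by have := ip_le_norm (- x) y; rewrite normrN -scaleN1r ipZl mulN1r.
Qed.

Lemma ip_eq0_norm (x : H) : ip x x = 0 -> x = 0.
Proof. by rewrite -ip_norm => /eqP; rewrite expf_eq0 /= normr_eq0 => /eqP. Qed.

End inner_product.

(** * Derivatives relative to a set *)
Section derivative_on.
Context (R : realType) (V : normedModType R) (I : set R).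
Implicit Types (w d : R -> V).

(** First-order expansion of [w] along [I], with slope [d t] at [t]; one-sided
    at the endpoints of a segment.  Unlike the limit of difference quotients it
    imposes no exception at s = t. *)
Definition has_deriv_on w d :=
  forall t, I t -> forall e : R, 0 < e -> exists2 r : R, 0 < r &
    forall s, I s -> `|s - t| < r -> `|w s - w t - (s - t) *: d t| <= e * `|s - t|.

Lemma has_deriv_on_ext w w' d d' :
  (forall t, I t -> w t = w' t) -> (forall t, I t -> d t = d' t) ->
  has_deriv_on w d -> has_deriv_on w' d'.
Proof.
move=> ww dd h t It e e0; have [r r0 hr] := h t It e e0.
by exists r => // s Is st; rewrite -!ww// -dd//; exact: hr.
Qed.

Lemma has_deriv_onD w d w' d' : has_deriv_on w d -> has_deriv_on w' d' ->
  has_deriv_on (fun t => w t + w' t) (fun t => d t + d' t).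
Proof.
move=> h h' t It e e0.
have [r r0 hr] := h t It (e / 2) ltac:(lra).
have [r' r'0 hr'] := h' t It (e / 2) ltac:(lra).
exists (Num.min r r'); first by rewrite lt_min r0.
move=> s Is; rewrite lt_min => /andP[sr sr'].
rewrite [X in `|X|](_ : _ =
  (w s - w t - (s - t) *: d t) + (w' s - w' t - (s - t) *: d' t)); last first.
  by rewrite scalerDr !opprD (addrACA (w s)) [LHS]addrACA.
apply: (le_trans (ler_normD _ _)).
have := hr s Is sr; have := hr' s Is sr'; lra.
Qed.

Lemma has_deriv_onZ (a : R) w d : has_deriv_on w d ->
  has_deriv_on (fun t => a *: w t) (fun t => a *: d t).
Proof.
move=> h t It e e0.
have a1 : 0 < `|a| + 1 by rewrite ltr_wpDl.
have [r r0 hr] := h t It (e / (`|a| + 1)) (divr_gt0 e0 a1).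
exists r => // s Is sr.
rewrite scalerA (mulrC (s - t)) -scalerA -!scalerBr normrZ.
have {}hr := hr s Is sr.
apply: (@le_trans _ _ ((`|a| + 1) * `|w s - w t - (s - t) *: d t|)).
  by rewrite ler_wpM2r// lerDl.
by rewrite -ler_pdivlMl// (le_trans hr)// mulrCA mulrA.
Qed.

Lemma has_deriv_on_cst (c : V) : has_deriv_on (fun=> c) (fun=> 0).
Proof.
move=> t It e e0; exists 1 => // s Is _.
by rewrite subrr scaler0 subr0 normr0 mulr_ge0// ltW.
Qed.

Lemma has_deriv_on_sum n (w d : nat -> R -> V) :
  (forall k, (k < n)%N -> has_deriv_on (w k) (d k)) ->
  has_deriv_on (fun t => \sum_(k < n) w k t) (fun t => \sum_(k < n) d k t).
Proof.
elim: n => [|n IH] h.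
  by apply: (has_deriv_on_ext _ _ (has_deriv_on_cst 0)) => t _; rewrite big_ord0.
apply: (has_deriv_on_ext _ _ (has_deriv_onD (IH _) (h n _))) => //.
- by move=> t _; rewrite big_ord_recr.
- by move=> t _; rewrite big_ord_recr.
- by move=> k kn; apply: h; rewrite ltnS ltnW.
Qed.

Lemma has_deriv_on_continuous w d t : has_deriv_on w d -> I t ->
  forall e : R, 0 < e -> exists2 r : R, 0 < r &
    forall s, I s -> `|s - t| < r -> `|w s - w t| <= e.
Proof.
move=> h It e e0; have [r r0 hr] := h t It 1 ltr01.
have M0 : 0 < 1 + `|d t| by rewrite ltr_wpDr.
exists (Num.min r (e / (1 + `|d t|))); first by rewrite lt_min r0 divr_gt0.
move=> s Is; rewrite lt_min ltr_pdivlMr// => /andP[sr se].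
have := hr s Is sr.
have := ler_normD (w s - w t - (s - t) *: d t) ((s - t) *: d t).
by rewrite subrK normrZ; lra.
Qed.

(** The product rule for a linear factor, from which the derivative of every
    Taylor monomial follows by induction. *)
Lemma has_deriv_on_mulX (c : R) w d : has_deriv_on w d ->
  has_deriv_on (fun t => (t - c) *: w t) (fun t => w t + (t - c) *: d t).
Proof.
move=> h t It e e0.
have M0 : 0 < 2 * (`|t - c| + 1) by rewrite mulr_gt0// ltr_wpDl.
have [r r0 hr] := h t It (e / (2 * (`|t - c| + 1))) (divr_gt0 e0 M0).
have [r' r'0 hr'] := has_deriv_on_continuous h It (e := e / 2) ltac:(lra).
exists (Num.min r r'); first by rewrite lt_min r0.
move=> s Is; rewrite lt_min => /andP[sr sr'].
have {}hr := hr s Is sr; have {}hr' := hr' s Is sr'.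
rewrite [X in `|X|](_ : _ =
  (t - c) *: (w s - w t - (s - t) *: d t) + (s - t) *: (w s - w t)); last first.
  have -> : s - c = (t - c) + (s - t) by lra.
  rewrite scalerDl scalerDr !scalerBr !scalerA (mulrC (t - c) (s - t)).
  by rewrite opprD [X in _ - _ + X]addrC (addrAC ((t - c) *: w s)) [LHS]addrACA. 
apply: (le_trans (ler_normD _ _)); rewrite !normrZ.
have h1 : `|t - c| * `|w s - w t - (s - t) *: d t| <= e / 2 * `|s - t|.
  apply: (@le_trans _ _ ((`|t - c| + 1) * `|w s - w t - (s - t) *: d t|)).
    by rewrite ler_wpM2r// lerDl.
  rewrite -ler_pdivlMl; last by rewrite ltr_wpDl.
  apply: (le_trans hr); rewrite le_eqVlt; apply/orP; left; apply/eqP.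
  have : `|t - c| + 1 != 0 by rewrite gt_eqF// ltr_wpDl.
  move: (`|t - c| + 1) => x x0; field; exact: x0.
have := ler_wpM2l (normr_ge0 (s - t)) hr'; lra.
Qed.

Lemma has_deriv_on_pow (c : R) (a : V) k :
  has_deriv_on (fun t => (t - c) ^+ k *: a)
               (fun t => (k%:R * (t - c) ^+ k.-1) *: a).
Proof.
elim: k => [|k IH].
  apply: (has_deriv_on_ext _ _ (has_deriv_on_cst a)) => t _.
    by rewrite expr0 scale1r.
  by rewrite mul0r scale0r.
apply: (has_deriv_on_ext _ _ (has_deriv_on_mulX c IH)) => t _.
  by rewrite scalerA -exprS.
rewrite scalerA -scalerDl; congr (_ *: _); rewrite /= mulrCA.
case: k {IH} => [|k] /=; first by rewrite mul0r mul1r expr0 addr0.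
by rewrite -exprS -[k.+2]addn1 natrD mulrDl mul1r addrC.
Qed.

(** A derivative inherits any Lipschitz bound; [t] must be an accumulation point
    of [I], since otherwise every vector is a derivative there. *)
Lemma deriv_norm_le w d (M : R) t : has_deriv_on w d -> I t ->
  (forall r : R, 0 < r -> exists s : R, [/\ I s, s != t & `|s - t| < r]) ->
  (forall s, I s -> `|w s - w t| <= M * `|s - t|) -> `|d t| <= M.
Proof.
move=> h It acc hM; apply/ler_addgt0Pl => e e0.
have [r r0 hr] := h t It e e0.
have [s [Is st sr]] := acc r r0.
have st0 : 0 < `|s - t| by rewrite normr_gt0 subr_eq0.
rewrite -(ler_pM2l st0) -normrZ.
have := ler_normB (w s - w t) (w s - w t - (s - t) *: d t).
rewrite opprB addrC subrK.
have := hM s Is; have := hr s Is sr; lra.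
Qed.

(** The difference of two derivatives is a derivative of a constant, and a
    constant is Lipschitz with constant 0. *)
Lemma has_deriv_on_unique w d d' t : has_deriv_on w d -> has_deriv_on w d' ->
  I t -> (forall r : R, 0 < r -> exists s : R, [/\ I s, s != t & `|s - t| < r]) ->
  d t = d' t.
Proof.
move=> h h' It acc; apply/eqP; rewrite -subr_eq0 -normr_le0.
have hN := has_deriv_onD h (has_deriv_onZ (-1) h').
suff : `|d t + -1 *: d' t| <= 0 by rewrite scaleN1r.
apply: (deriv_norm_le hN It acc) => s Is.
by rewrite !scaleN1r !subrr normr0 mul0r.
Qed.

End derivative_on.

Section segment.
Context (R : realType) (T : R) (T_gt0 : 0 < T).
Local Notation I := (`[0, T]%classic : set R).

Lemma segmentP (t : R) : I t <-> 0 <= t <= T.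
Proof. by rewrite /= in_itv /=. Qed.

Lemma segment_acc t : I t ->
  forall r : R, 0 < r -> exists s : R, [/\ I s, s != t & `|s - t| < r].
Proof.
move=> /segmentP /andP[t0 tT] r r0.
have [tlt|tge] := ltP t (T / 2).
  exists (t + Num.min (r / 2) (T / 2)).
  have m0 : 0 < Num.min (r / 2) (T / 2) by rewrite lt_min !divr_gt0.
  have mr : Num.min (r / 2) (T / 2) <= r / 2 by rewrite ge_min lexx.
  have mT : Num.min (r / 2) (T / 2) <= T / 2 by rewrite ge_min lexx orbT.
  split; first by apply/segmentP; apply/andP; split; lra.
    by rewrite gt_eqF// ltrDl.
  by rewrite addrC addKr gtr0_norm//; lra.
exists (t - Num.min (r / 2) (T / 2)).
have m0 : 0 < Num.min (r / 2) (T / 2) by rewrite lt_min !divr_gt0.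
have mr : Num.min (r / 2) (T / 2) <= r / 2 by rewrite ge_min lexx.
have mT : Num.min (r / 2) (T / 2) <= T / 2 by rewrite ge_min lexx orbT.
split; first by apply/segmentP; apply/andP; split; lra.
  by rewrite lt_eqF// gtrBl.
by rewrite distrC opprB addrC subrK gtr0_norm//; lra.
Qed.

End segment.

(** The passage from limits of difference quotients to expansions. *)
Lemma deriv_withinP (R : realType) (H : completeNormedModType R) (I : set R) (w : R -> H) :
  derivable_within I w -> has_deriv_on I w (deriv_within I w).
Proof.
move=> dw t It e e0; have := dw t It.
rewrite /deriv_within; set l := lim _ => wl.
have /= /(_ _) := (@cvgrPdist_le _ _ _ _ _ _ _).1 wl e e0.
rewrite near_withinE /dnbhs near_withinE => /nbhs_ballP[r /= r0 hr].
exists r => // s Is sr.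
have [->|st] := eqVneq s t.
  by rewrite !subrr scale0r subr0 !normr0 mulr0.
have {}hr := hr s _ st Is.
have st' : s - t != 0 by rewrite subr_eq0.
rewrite -[w s - w t](@scalerKV _ _ (s - t))// -scalerBr normrZ mulrC.
by rewrite ler_wpM2r// distrC hr// /ball /= distrC.
Qed.


(** * Mean value inequality and Taylor's formula *)
Section mean_value.
Context (R : realType) (H : completeNormedModType R) (ip : {dot H for (@idfun R)}).
Context (ip_norm : induces_norm ip) (T : R) (T_gt0 : 0 < T).
Local Notation I := (`[0, T]%classic : set R).
Implicit Types (w d : R -> H).

Lemma has_deriv_on_ip w d (e : H) : has_deriv_on I w d ->
  has_deriv_on (V := R^o) I (fun t => ip (w t) e) (fun t => ip (d t) e).
Proof.
move=> h t It x x0.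
have M0 : 0 < `|e| + 1 by rewrite ltr_wpDl.
have [r r0 hr] := h t It (x / (`|e| + 1)) (divr_gt0 x0 M0).
exists r => // s Is sr; have {}hr := hr s Is sr.
have -> : ip (w s) e - ip (w t) e - (s - t) *: (ip (d t) e : R^o)
  = ip (w s - w t - (s - t) *: d t) e by rewrite !ipBl ipZl.
apply: (le_trans (ler_norm_ip ip_norm _ _)).
apply: (@le_trans _ _ (`|w s - w t - (s - t) *: d t| * (`|e| + 1))).
  by rewrite ler_wpM2l// lerDl.
by rewrite -ler_pdivlMr// mulrAC.
Qed.

Lemma has_deriv_on_mvt (f df : R -> R) a b :
  has_deriv_on (V := R^o) I f df -> I a -> I b -> a < b ->
  exists2 c, a < c < b & f b - f a = df c * (b - a).
Proof.
move=> h /segmentP/andP[a0 aT] /segmentP/andP[b0 bT] ab.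
have abI c : a <= c <= b -> I c.
  by move=> /andP[? ?]; apply/segmentP; apply/andP; split; lra.
have [||c cab ->] := @MVT R f df a b ab; last first.
- by exists c => //; move: cab; rewrite in_itv.
- apply/subspace_continuousP => x xab.
  apply/cvgrPdist_le => e e0; rewrite near_withinE.
  have Ix : I x by apply: abI; move: xab; rewrite /= in_itv.
  have [r r0 hr] := has_deriv_on_continuous h Ix e0.
  apply/nbhs_ballP; exists r => //= s sr sab; rewrite distrC; apply: hr.
    by apply: abI; move: sab; rewrite /= in_itv.
  by rewrite distrC.
- move=> c; rewrite in_itv /= => /andP[ac cb].
  have Ic : I c by apply: abI; rewrite !ltW.
  have hc : (fun h => h^-1 *: ((f \o shift c) (h *: (1 : R^o)) - f c)) @ 0^' --> df c.
    apply/cvgrPdist_le => e e0; rewrite /dnbhs near_withinE.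
    have [r r0 hr] := h c Ic e e0.
    apply/nbhs_ballP; exists (Num.min r (Num.min (c - a) (b - c))) => /=.
      by rewrite !lt_min r0 !subr_gt0 ac.
    move=> k; rewrite /ball /= sub0r normrN !lt_min => /and3P[kr ka kb] k0.
    have Ik : I (k + c).
      apply: abI; move: ka kb; rewrite !ltr_norml => /andP[? ?] /andP[? ?].
      by apply/andP; split; lra.
    have := hr (k + c) Ik; rewrite addrK => /(_ kr) hk.
    have k0' : 0 < `|k| by rewrite normr_gt0.
    rewrite distrC -(ler_pM2l k0') -normrM (mulrC _ e).
    apply: le_trans hk; rewrite /shift /= le_eqVlt; apply/orP; left; apply/eqP; congr `|_|.
    rewrite /GRing.scale /= mulr1 mulrBr mulrA mulfV// mul1r.
    by rewrite mulrC.
  by apply: DeriveDef; [apply: cvgP hc|apply: cvg_lim hc].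
Qed.

(** Vector-valued functions have no mean value equality; the scalar one is applied
    to the component of [w] along its own increment w b - w a. *)
Lemma mean_value_le w d (M a b : R) : has_deriv_on I w d -> I a -> I b ->
  (forall s, I s -> `|s - a| <= `|b - a| -> `|d s| <= M) ->
  `|w b - w a| <= M * `|b - a|.
Proof.
move=> h Ia Ib hM.
have [->|wab] := eqVneq (w b) (w a).
  rewrite subrr normr0 mulr_ge0//; apply: le_trans (normr_ge0 _) (hM a Ia _).
  by rewrite subrr normr0.
have e0 : 0 < `|w b - w a| by rewrite normr_gt0 subr_eq0.
rewrite -(ler_pM2l e0) -expr2 ip_norm.
set e := w b - w a in e0 *; rewrite {1}/e ipBl.
have hi := has_deriv_on_ip e h.
suff [c [Ic cab ->]] : exists c, [/\ I c, `|c - a| <= `|b - a| &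
    ip (w b) e - ip (w a) e = ip (d c) e * (b - a)].
  apply: (le_trans (ler_norm _)); rewrite normrM mulrA ler_wpM2r//.
  by apply: (le_trans (ler_norm_ip ip_norm _ _)); rewrite mulrC ler_wpM2l// hM.
move: (Ia) (Ib) => /segmentP/andP[a0 aT] /segmentP/andP[b0 bT].
have [ab|ba|eab] := ltgtP a b; last by move: wab; rewrite eab eqxx.
  have [c /andP[ac cb] E] := has_deriv_on_mvt hi Ia Ib ab.
  exists c; split => //; first by apply/segmentP; apply/andP; split; lra.
  by rewrite !gtr0_norm ?subr_gt0//; lra.
have [c /andP[ac cb] E] := has_deriv_on_mvt hi Ib Ia ba.
exists c; split => //; first by apply/segmentP; apply/andP; split; lra.
  by rewrite !ltr0_norm ?subr_lt0//; lra.
by rewrite -opprB E -mulrN opprB.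
Qed.

Definition lipschitz_on_seg (M : R) w :=
  forall s t, I s -> I t -> `|w s - w t| <= M * `|s - t|.

(** Only a Lipschitz bound on the last derivative is available, not one more
    derivative, so the induction starts from the Lipschitz inequality itself.
    The remainder of order n + 1 has as derivative the remainder of order n of
    the derivative, and vanishes at [t]; the mean value inequality gains a
    factor |s - t|. *)
Lemma taylor_remainder_le n (M : R) (w : nat -> R -> H) :
  (forall k, (k < n)%N -> has_deriv_on I (w k) (w k.+1)) ->
  lipschitz_on_seg M (w n) -> 0 <= M ->
  forall s t, I s -> I t ->
  `|w 0 s - \sum_(k < n.+1) ((s - t) ^+ k / k`!%:R) *: w k t|
    <= M * `|s - t| ^+ n.+1.
Proof.
elim: n w => [|n IH] w hw hM M0 s t Is It.
  by rewrite big_ord1 expr0 fact0 divr1 scale1r expr1; exact: hM.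
have hr := has_deriv_onD (hw 0 isT) (has_deriv_onZ (-1)
  (has_deriv_on_sum (n := n.+2) (w := fun k s => (s - t) ^+ k *: (k`!%:R^-1 *: w k t))
   (fun k _ => has_deriv_on_pow t (k`!%:R^-1 *: w k t) k))).
have H1 := mean_value_le (M := M * `|s - t| ^+ n.+1) hr It Is.
rewrite /= in H1; rewrite exprSr mulrA; apply: le_trans (H1 _); last first.
  move=> r Ir rs; rewrite scaleN1r big_ord_recl /= mul0r scale0r add0r.
  rewrite (_ : \sum_(i < n.+1) _ = \sum_(i < n.+1) ((r - t) ^+ i / i`!%:R) *: w i.+1 t).
    apply: (le_trans (IH (fun k => w k.+1) _ hM M0 r t Ir It)).
      by move=> k kn; exact: hw.
    by rewrite ler_wpM2l// lerXn2r// ?nnegrE.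
  apply: eq_bigr => i _; rewrite /bump /= add1n scalerA /=; congr (_ *: _).
  rewrite factS natrM invfM mulrACA mulfV ?pnatr_eq0// mul1r mulrC.
  by [].
rewrite !scaleN1r [in X in _ <= `|_ - X|]big_ord_recl /= [\sum_(i < n.+1) _]big1.
  rewrite addr0 expr0 scale1r fact0 invr1 scale1r subrr subr0.
  by rewrite le_eqVlt; apply/orP; left; apply/eqP; congr (`|_ - _|);
    apply: eq_bigr => i _; rewrite scalerA.
by move=> i _; rewrite /bump /= add1n subrr exprS mul0r scale0r.
Qed.

End mean_value.

(** * Self-adjoint operators *)
Section operator_linearity.
Context (R : realType) (H : completeNormedModType R) (A : unbounded_operator H).
Implicit Types x y : H.

Lemma domZ (a : R) x : dom A x -> dom A (a *: x).
Proof. by move=> Ax; have := dom_lin a Ax (dom0 A); rewrite addr0. Qed.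

Lemma domD x y : dom A x -> dom A y -> dom A (x + y).
Proof. by move=> Ax Ay; have := dom_lin 1 Ax Ay; rewrite scale1r. Qed.

Lemma domB x y : dom A x -> dom A y -> dom A (x - y).
Proof. by move=> Ax Ay; rewrite -scaleN1r; apply: domD => //; apply: domZ. Qed.

Lemma opfun0 : A 0 = 0.
Proof.
have := opfun_lin 1 (dom0 A) (dom0 A); rewrite !scale1r addr0 => /eqP.
by rewrite -subr_eq0 opprD addrA subrr sub0r oppr_eq0 => /eqP.
Qed.

Lemma opfunZ (a : R) x : dom A x -> A (a *: x) = a *: A x.
Proof.
by move=> Ax; have := opfun_lin a Ax (dom0 A); rewrite opfun0 !addr0.
Qed.

Lemma opfunD x y : dom A x -> dom A y -> A (x + y) = A x + A y.
Proof. by move=> Ax Ay; have := opfun_lin 1 Ax Ay; rewrite !scale1r. Qed.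

Lemma opfunB x y : dom A x -> dom A y -> A (x - y) = A x - A y.
Proof.
move=> Ax Ay; rewrite -[in LHS]scaleN1r opfunD//; last exact: domZ.
by rewrite opfunZ// scaleN1r.
Qed.

End operator_linearity.

Section riesz.
Context (R : realType) (H : completeNormedModType R) (ip : {dot H for (@idfun R)}).
Context (ip_norm : induces_norm ip).

(** The Riesz representation theorem for a functional that is defined and bounded
    on the domain of an operator only.  The quadratic functional
    J x = |x|^2 / 2 - f x is bounded below; by the parallelogram identity its
    minimizing sequences are Cauchy, and their limit represents [f].  Working
    with J on the domain avoids extending [f] to the closure. *)
Lemma riesz_on_domain (A : unbounded_operator H) (f : H -> R) (K : R) :
  (forall (a : R) x y, dom A x -> dom A y -> f (a *: x + y) = a * f x + f y) ->
  (forall x, dom A x -> `|f x| <= K * `|x|) ->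
  exists z, forall x, dom A x -> f x = ip x z.
Proof.
move=> flin fK.
pose J x : R := ip x x / 2 - f x.
pose E : set R := [set J x | x in dom A].
have Elb x : dom A x -> - (K ^+ 2 / 2) <= J x.
  move=> Ax; rewrite /J -ip_norm; have := fK x Ax.
  have := ler_norm (f x); have := sqr_ge0 (`|x| - K); nra.
have hE : has_inf E.
  split; first by exists (J 0), 0 => //; exact: dom0.
  by exists (- (K ^+ 2 / 2)) => _ [x Ax <-]; exact: Elb.
have mJ x : dom A x -> inf E <= J x.
  by move=> Ax; apply: ge_inf; [exact: hE.2|exists x].
have /choice[xn Hxn] : forall n, exists x, dom A x /\ J x < inf E + n.+1%:R^-1.
  move=> n.
  have n0 : 0 < n.+1%:R^-1 :> R by rewrite invr_gt0.
  by have [_ [x Ax <-] xE] := inf_adherent n0 hE; exists x.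
have fZ (a : R) x : dom A x -> f (a *: x) = a * f x.
  move=> Ax; have f0 : f 0 = 0.
    by have := flin 1 0 0 (dom0 A) (dom0 A); rewrite scale1r addr0; lra.
  by have := flin a x 0 Ax (dom0 A); rewrite f0 !addr0.
have fD x y : dom A x -> dom A y -> f (x + y) = f x + f y.
  by move=> Ax Ay; have := flin 1 x y Ax Ay; rewrite scale1r mul1r.
(* parallelogram identity, tested against the midpoint of x_n and x_m *)
have close m n : (m <= n)%N -> `|xn n - xn m| ^+ 2 <= 8 * m.+1%:R^-1.
  move=> mn; have [Am Jm] := Hxn m; have [An Jn] := Hxn n.
  have := mJ _ (domZ 2^-1 (domD An Am)).
  have : n.+1%:R^-1 <= m.+1%:R^-1 :> R by rewrite lef_pV2 ?posrE// ler_nat.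
  move: Jm Jn; rewrite /J fZ ?fD//; last exact: domD.
  rewrite ip_norm !(ipZl, ipZr, ipBl, ipBr, ipDl, ipDr) (ipC ip (xn n) (xn m)).
  move: (m.+1%:R^-1) (n.+1%:R^-1) => em en; lra.
have /cvg_ex[z xz] : cvg (xn n @[n --> \oo]).
  apply/cauchy_cvgP; apply: cauchy_exP => e e0.
  have e8 : 0 < e ^+ 2 / 8 by rewrite divr_gt0// exprn_gt0.
  have [m _ /(_ m (leqnn m))/= hm] := near_infty_natSinv_lt (PosNum e8).
  exists (xn m); exists m => // n /= mn.
  rewrite -ball_normE /= distrC -(@ltr_pXn2r _ 2)// ?nnegrE// ?ltW//.
  apply: (le_lt_trans (close m n mn)).
  by rewrite -ltr_pdivlMl// mulrC.
have limclose m : `|z - xn m| ^+ 2 <= 8 * m.+1%:R^-1.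
  have cv : `|xn n - xn m| ^+ 2 @[n --> \oo] --> `|z - xn m| ^+ 2.
    by apply: cvgM; apply: cvg_norm; apply: cvgB => //; exact: cvg_cst.
  apply: (cvgr_to_le cv); exists m => // n /= mn; exact: close.
exists z => w Aw; apply/eqP; rewrite -subr_eq0 -sqrf_eq0 eq_le sqr_ge0 andbT.
set C := 4 * (`|w| ^+ 2 + 1) + 16 * `|w| ^+ 2.
have C0 : 0 < C.
  by rewrite /C; have := sqr_ge0 `|w|; lra.
have key m : (f w - ip w z) ^+ 2 <= C * m.+1%:R^-1.
  have [Am Jm] := Hxn m.
  set g := f w - ip w (xn m).
  have W1 : 0 < `|w| ^+ 2 + 1 by rewrite ltr_wpDl// sqr_ge0.
  (* J (x_m + t w) >= inf J; this t nearly minimizes the left-hand side, and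
     the 1 avoids dividing by zero when w = 0 *)
  set t := g / (`|w| ^+ 2 + 1).
  have tg : g = t * (`|w| ^+ 2 + 1) by rewrite /t divfK// gt_eqF.
  have := mJ _ (domD Am (domZ t Aw)).
  move: Jm; rewrite /J fD ?fZ//; last exact: domZ.
  rewrite !(ipDl, ipDr, ipZl, ipZr) (ipC ip (xn m) w) -(ip_norm w) => J1 J2.
  have fw : f w = ip w (xn m) + g by rewrite /g addrC subrK.
  have h1 : t ^+ 2 * (`|w| ^+ 2 + 2) <= 2 * m.+1%:R^-1.
    move: J1 J2; rewrite fw tg; move: (m.+1%:R^-1) => em; lra.
  have h2 : g ^+ 2 <= 2 * (`|w| ^+ 2 + 1) * m.+1%:R^-1.
    have h1' := ler_wpM2r (ltW W1) h1.
    have t2 : 0 <= t ^+ 2 * (`|w| ^+ 2 + 1) by rewrite mulr_ge0 ?sqr_ge0// ltW.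
    rewrite tg; move: h1' t2; move: (m.+1%:R^-1) (`|w| ^+ 2) => em W; lra.
  have h3 : (ip w (z - xn m)) ^+ 2 <= `|w| ^+ 2 * (8 * m.+1%:R^-1).
    apply: (@le_trans _ _ ((`|w| * `|z - xn m|) ^+ 2)).
      by rewrite -[leLHS]real_normK ?num_real// ler_sqr ?nnegrE ?mulr_ge0// ler_norm_ip.
    by rewrite exprMn ler_wpM2l// sqr_ge0.
  have -> : f w - ip w z = g - ip w (z - xn m) by rewrite ipBr /g; lra.
  have := sqr_ge0 (g + ip w (z - xn m)).
  rewrite /C; move: h2 h3; move: (m.+1%:R^-1) (ip w _) => em i; lra.
apply/ler_addgt0Pl => e e0; rewrite addr0.
have eC : 0 < e / C by rewrite divr_gt0.
have [m _ /(_ m (leqnn m))/= hm] := near_infty_natSinv_lt (PosNum eC).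
apply: (le_trans (key m)); rewrite -ler_pdivlMl// mulrC; exact: ltW.
Qed.

End riesz.

Section self_adjoint_operators.
Context (R : realType) (H : completeNormedModType R) (ip : {dot H for (@idfun R)}).
Context (ip_norm : induces_norm ip).
Context (A : unbounded_operator H) (A_sa : self_adjoint ip A).

Lemma self_adjoint_sym x y : dom A x -> dom A y -> ip (A x) y = ip x (A y).
Proof. by move=> Ax Ay; apply: ((A_sa.2 y (A y)).1 (conj Ay erefl)). Qed.

Lemma self_adjoint_dom y z :
  (forall x, dom A x -> ip (A x) y = ip x z) -> dom A y /\ A y = z.
Proof. exact: (A_sa.2 y z).2. Qed.

(** D(A) = D(A^* ): it is enough that x |-> (A x, y) be bounded, since the vector
    representing it is then A y. *)
Lemma self_adjoint_dom_bounded y (K : R) :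
  (forall x, dom A x -> `|ip (A x) y| <= K * `|x|) -> dom A y.
Proof.
move=> h; have [|z hz] := riesz_on_domain ip_norm (f := fun x => ip (A x) y) _ h.
  by move=> a x x' Ax Ax'; rewrite opfun_lin// ipDl ipZl.
by have [] := self_adjoint_dom hz.
Qed.

Context (T : R) (T_gt0 : 0 < T).
Local Notation I := (`[0, T]%classic : set R).

(** A self-adjoint operator is closed, so it commutes with derivatives.  The weak
    form needs no limit: for each x in D(A) the scalar functions (w, A x) and
    (A w, x) are equal, hence so are their derivatives. *)
Lemma self_adjoint_deriv (w dw daw : R -> H) :
  has_deriv_on I w dw -> has_deriv_on I (fun t => A (w t)) daw ->
  (forall t, I t -> dom A (w t)) ->
  forall t, I t -> dom A (dw t) /\ A (dw t) = daw t.
Proof.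
move=> hw haw Aw t It; apply: self_adjoint_dom => x Ax.
rewrite ipC (ipC _ x).
have h1 := has_deriv_on_ip ip_norm (A x) hw.
have h2 := has_deriv_on_ip ip_norm x haw.
have h3 : has_deriv_on (V := R^o) I (fun s => ip (w s) (A x)) (fun s => ip (daw s) x).
  by apply: has_deriv_on_ext h2 => // s Is; exact: self_adjoint_sym (Aw s Is) Ax.
exact: (has_deriv_on_unique h1 h3 It (segment_acc T_gt0 It)).
Qed.

(** A derivative can lie in D(A) without A w being differentiable: the difference
    quotients of A w are merely bounded, and boundedness of x |-> (A x, dw t) is
    all that self-adjointness asks for.  This places u'' in D(A). *)
Lemma dom_deriv_of_lipschitz (M : R) (w dw : R -> H) :
  has_deriv_on I w dw -> (forall t, I t -> dom A (w t)) ->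
  lipschitz_on_seg T M (fun t => A (w t)) ->
  forall t, I t -> dom A (dw t).
Proof.
move=> hw Aw hM t It; apply: (self_adjoint_dom_bounded (K := M)) => x Ax.
rewrite ipC; have h1 := has_deriv_on_ip ip_norm (A x) hw.
apply: (deriv_norm_le h1 It (segment_acc T_gt0 It)) => s Is.
rewrite -ipBl -self_adjoint_sym//; [|exact: domB (Aw s Is) (Aw t It)].
rewrite opfunB; [|exact: Aw..].
apply: (le_trans (ler_norm_ip ip_norm _ _)).
by rewrite mulrAC ler_wpM2r// hM.
Qed.

Context (S : unbounded_operator H) (SA : is_sqrt_op ip A S).

Lemma dom_sqrt x : dom A x -> dom S x.
Proof. by case: SA => _ _ h _ /h[]. Qed.

Lemma ip_sqrt x : dom A x -> ip (A x) x = `|S x| ^+ 2.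
Proof.
case: SA => S_sa _ h hS Ax; have [Sx SSx] := (h x).1 Ax.
by rewrite hS// ip_norm ((S_sa.2 x (S x)).1 (conj Sx erefl)).
Qed.

Lemma norm_sqrt_le x : dom A x -> `|S x| ^+ 2 <= `|A x| * `|x|.
Proof. by move=> Ax; rewrite -ip_sqrt//; exact: ip_le_norm. Qed.

End self_adjoint_operators.

(** * Second differences *)
Section taylor_consequences.
Context (R : realType) (H : completeNormedModType R) (ip : {dot H for (@idfun R)}).
Context (ip_norm : induces_norm ip).

(** Reduces an identity between vectors to one between real numbers. *)
Lemma ip_inj (x y : H) : (forall e, ip x e = ip y e) -> x = y.
Proof.
move=> h; apply/eqP; rewrite -subr_eq0; apply/eqP/(ip_eq0_norm ip_norm).
by rewrite ipBl h subrr.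
Qed.

Context (T : R) (T_gt0 : 0 < T).
Local Notation I := (`[0, T]%classic : set R).
Implicit Types (w d : R -> H) (M : R).

Lemma lipschitz_seg_bounded M w : 0 <= M -> lipschitz_on_seg T M w ->
  exists2 K, 0 <= K & forall t, I t -> `|w t| <= K.
Proof.
move=> M0 hM; have I0 : I 0 by apply/segmentP; rewrite lexx ltW.
exists (`|w 0| + M * T) => [|t It]; first by rewrite addr_ge0// mulr_ge0// ltW.
rewrite -[w t](subrK (w 0)) addrC; apply: (le_trans (ler_normD _ _)).
rewrite lerD2l; apply: (le_trans (hM t 0 It I0)); rewrite ler_wpM2l// subr0.
by move/segmentP: It => /andP[t0 tT]; rewrite ger0_norm.
Qed.

Lemma deriv_bounded_lipschitz K w d : has_deriv_on I w d ->
  (forall t, I t -> `|d t| <= K) -> lipschitz_on_seg T K w.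
Proof.
by move=> h hK s t Is It; apply: (mean_value_le ip_norm h It Is) => r Ir _; exact: hK.
Qed.

Lemma lipschitz_on_segP w : [lipschitz w t | t in I] ->
  exists2 M, 0 <= M & lipschitz_on_seg T M w.
Proof.
move=> h; have [M [M0 hM]] := pinfty_ex_gt0 h.
by exists M => [|s t Is It]; [exact: ltW|exact: (hM (s, t))].
Qed.

Lemma lipschitz_on_seg_weaken M M' w : M <= M' ->
  lipschitz_on_seg T M w -> lipschitz_on_seg T M' w.
Proof.
by move=> MM h s t Is It; apply: (le_trans (h s t Is It)); rewrite ler_wpM2r.
Qed.

Lemma taylor1_le M (w w1 : R -> H) : 0 <= M -> has_deriv_on I w w1 ->
  lipschitz_on_seg T M w1 -> forall s t, I s -> I t ->
  `|w s - w t - (s - t) *: w1 t| <= M * `|s - t| ^+ 2.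
Proof.
move=> M0 h hM s t Is It.
have := @taylor_remainder_le _ _ _ ip_norm _ 1 M (fun k => nth w [:: w; w1] k) _ hM M0 s t Is It.
rewrite !big_ord_recr big_ord0 /= => /(_ _) hh.
have E : w s - w t - (s - t) *: w1 t = w s - (0 + ((s - t) ^+ 0 / 0`!%:R) *: w t +
  ((s - t) ^+ 1 / 1`!%:R) *: w1 t).
  by rewrite add0r !divr1 expr0 expr1 scale1r opprD addrA.
by rewrite E; apply: hh; case.
Qed.

Lemma taylor2_le M (w w1 w2 : R -> H) : 0 <= M ->
  has_deriv_on I w w1 -> has_deriv_on I w1 w2 ->
  lipschitz_on_seg T M w2 -> forall s t, I s -> I t ->
  `|w s - (w t + (s - t) *: w1 t + ((s - t) ^+ 2 / 2) *: w2 t)| <= M * `|s - t| ^+ 3.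
Proof.
move=> M0 h h1 hM s t Is It.
have := @taylor_remainder_le _ _ _ ip_norm _ 2 M (fun k => nth w [:: w; w1; w2] k) _ hM
  M0 s t Is It.
rewrite !big_ord_recr big_ord0 /= add0r !divr1 expr0 expr1 scale1r; apply.
by case=> [|[]].
Qed.

Lemma second_difference1_le M (w w1 : R -> H) : 0 <= M ->
  has_deriv_on I w w1 -> lipschitz_on_seg T M w1 ->
  forall t h, I t -> I (t + h) -> I (t - h) ->
  `|w (t + h) + w (t - h) - 2 *: w t| <= 2 * M * h ^+ 2.
Proof.
move=> M0 h1 hM t h It Ip Im.
have := taylor1_le M0 h1 hM Ip It; have := taylor1_le M0 h1 hM Im It.
rewrite (addrC t) (addrC t) !addrK normrN -normrX ger0_norm ?sqr_ge0//.
set x := (X in `|X| <= _ -> _) => hx; set y := (X in `|X| <= _ -> _) => hy.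
rewrite [X in `|X|](_ : _ = x + y); last first.
  by apply: ip_inj => e; rewrite /x /y !(ipZl, ipBl, ipDl); ring.
by apply: (le_trans (ler_normD _ _)); lra.
Qed.

(** The odd Taylor terms cancel, which gives one order more than the remainder of
    a second-order expansion would. *)
Lemma second_difference3_le M (w w1 w2 w3 : R -> H) : 0 <= M ->
  has_deriv_on I w w1 -> has_deriv_on I w1 w2 -> has_deriv_on I w2 w3 ->
  lipschitz_on_seg T M w3 ->
  forall t h, I t -> I (t + h) -> I (t - h) ->
  `|w (t + h) + w (t - h) - 2 *: w t - h ^+ 2 *: w2 t| <= 2 * M * h ^+ 4.
Proof.
move=> M0 h1 h2 h3 hM t h It Ip Im.
have hh k : (k < 3)%N -> has_deriv_on I (nth w [:: w; w1; w2; w3] k)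
    (nth w [:: w; w1; w2; w3] k.+1) by case: k => [|[|[]]].
have := taylor_remainder_le ip_norm hh hM M0 Ip It.
have := taylor_remainder_le ip_norm hh hM M0 Im It.
rewrite (addrC t) (addrC t) !addrK normrN -normrX ger0_norm ?exprn_even_ge0//.
rewrite !big_ord_recr !big_ord0 /=.
set x := (X in `|X| <= _ -> _) => hx; set y := (X in `|X| <= _ -> _) => hy.
rewrite [X in `|X|](_ : _ = x + y); last first.
  apply: ip_inj => e; rewrite /x /y !(ipZl, ipBl, ipDl, ip0l).
  by rewrite !factS fact0; field.
by apply: (le_trans (ler_normD _ _)); lra.
Qed.

End taylor_consequences.

(** * Energy estimate *)
Section energy.
Context (R : realType) (H : completeNormedModType R) (ip : {dot H for (@idfun R)}).
Context (ip_norm : induces_norm ip).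

Lemma sqr_norm_add3_le (x y z : H) :
  `|x + y + z| ^+ 2 <= 3 * (`|x| ^+ 2 + `|y| ^+ 2 + `|z| ^+ 2).
Proof.
have h : `|x + y + z| <= `|x| + `|y| + `|z|.
  by apply: (le_trans (ler_normD _ _)); rewrite lerD2r ler_normD.
apply: (@le_trans _ _ ((`|x| + `|y| + `|z|) ^+ 2)).
  by rewrite lerXn2r// nnegrE ?addr_ge0.
have := sqr_ge0 (`|x| - `|y|); have := sqr_ge0 (`|y| - `|z|).
have := sqr_ge0 (`|x| - `|z|); lra.
Qed.

(** Pairing with z2 - z0 = (z2 - z1) + (z1 - z0) turns the second difference into
    a difference of squares, and, [G] being symmetric, the average of G z2 and
    G z0 into a difference of quadratic forms. *)
Lemma three_layer_energy_le (G : H -> H) (z0 z1 z2 g : H) (q tau : R) :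
  0 < tau -> ip (G z2) z0 = ip (G z0) z2 ->
  (tau ^+ 2)^-1 *: (z2 - z1 - (z1 - z0)) + q *: (2^-1 *: (G z2 + G z0)) = g ->
  `|tau^-1 *: (z2 - z1)| ^+ 2 + q / 2 * (ip (G z2) z2 - ip (G z0) z0)
    <= `|tau^-1 *: (z1 - z0)| ^+ 2 + tau * (`|g| ^+ 2 +
      (`|tau^-1 *: (z2 - z1)| ^+ 2 + `|tau^-1 *: (z1 - z0)| ^+ 2) / 2).
Proof.
move=> tau0 Gsym eg.
set p := tau^-1 *: (z2 - z1); set m := tau^-1 *: (z1 - z0).
have tau0' : tau != 0 by rewrite gt_eqF.
have E : `|p| ^+ 2 + q / 2 * (ip (G z2) z2 - ip (G z0) z0) =
    `|m| ^+ 2 + tau * ip g (p + m).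
  rewrite -eg !ip_norm /p /m !(ipZl, ipZr, ipBl, ipBr, ipDl, ipDr) Gsym.
  rewrite (ipC ip z1 z2) (ipC ip z0 z2) (ipC ip z0 z1); field; exact: tau0'.
rewrite E lerD2l ler_pM2l// ipDr.
have := ip_le_norm ip_norm g p; have := ip_le_norm ip_norm g m.
have := sqr_ge0 (`|g| - `|p|); have := sqr_ge0 (`|g| - `|m|); lra.
Qed.

Context (A S : unbounded_operator H) (C : {linear H -> H}).
Context (A_sa : self_adjoint ip A) (SA : is_sqrt_op ip A S).
Context (C_sym : symmetric_operator ip C) (C_ge0 : forall x : H, 0 <= ip (C x) x).
Context (gamma delta : R) (gamma_gt0 : 0 < gamma) (delta_gt0 : 0 < delta).
Local Notation L := (Lop gamma delta A C).

Lemma ip_Lop_sym x y : dom A x -> dom A y -> ip (L x) y = ip (L y) x.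
Proof.
move=> Ax Ay; rewrite /Lop !(ipDl, ipZl) (self_adjoint_sym A_sa Ax Ay) C_sym.
by rewrite (ipC ip x) (ipC ip x).
Qed.

Lemma ip_Lop_ge x : dom A x -> gamma * `|S x| ^+ 2 <= ip (L x) x.
Proof.
move=> Ax; rewrite /Lop ipDl !ipZl (ip_sqrt ip_norm SA Ax) lerDl.
by rewrite mulr_ge0 ?C_ge0 ?ltW.
Qed.

(** [z] and [y] are the errors in the first and in the second unknown. The weight
    [q k] varies with [k], which is what makes the energy of two consecutive
    steps differ even without forcing. *)
Definition energy (tau : R) (q : nat -> R) (z y : nat -> H) (k : nat) : R :=
  `|tau^-1 *: fdiff z k| ^+ 2 + q k / 2 * (`|S (z k.+1)| ^+ 2 + `|S (z k)| ^+ 2) +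
  (`|tau^-1 *: fdiff y k| ^+ 2 + 2^-1 * (ip (L (y k.+1)) (y k.+1) + ip (L (y k)) (y k))).

Section one_step.
Context (tau alpha : R) (q : nat -> R) (z y : nat -> H) (k : nat).
Context (alpha_gt0 : 0 < alpha) (q_ge : alpha <= q k).
Context (Ay : dom A (y k)) (Ay' : dom A (y k.+1)).

Let Sy0 : 0 <= ip (L (y k)) (y k).
Proof. by apply: le_trans (ip_Lop_ge Ay); rewrite mulr_ge0 ?sqr_ge0 ?ltW. Qed.

Let Sy0' : gamma * `|S (y k.+1)| ^+ 2 <= ip (L (y k.+1)) (y k.+1).
Proof. exact: ip_Lop_ge. Qed.

Let Sz0 : alpha / 2 * (`|S (z k.+1)| ^+ 2 + `|S (z k)| ^+ 2) <=
  q k / 2 * (`|S (z k.+1)| ^+ 2 + `|S (z k)| ^+ 2).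
Proof. by rewrite ler_wpM2r ?addr_ge0 ?sqr_ge0// ler_wpM2r. Qed.

Lemma energy_ge : `|tau^-1 *: fdiff z k| ^+ 2 + `|tau^-1 *: fdiff y k| ^+ 2 +
    alpha / 2 * (`|S (z k.+1)| ^+ 2 + `|S (z k)| ^+ 2) +
    gamma / 2 * `|S (y k.+1)| ^+ 2 <= energy tau q z y k.
Proof. by rewrite /energy; move: Sy0 Sy0' Sz0; lra. Qed.

Lemma energy_ge0 : 0 <= energy tau q z y k.
Proof.
apply: le_trans energy_ge; have a2 : 0 <= alpha / 2 by rewrite divr_ge0// ltW.
have g2 : 0 <= gamma / 2 by rewrite divr_ge0// ltW.
by rewrite !addr_ge0 ?sqr_ge0// mulr_ge0 ?addr_ge0 ?sqr_ge0.
Qed.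

Lemma sqrt_le_energy : `|S (z k.+1)| ^+ 2 + `|S (z k)| ^+ 2 <=
  2 / alpha * energy tau q z y k.
Proof.
have -> : 2 / alpha = (alpha / 2)^-1 by rewrite invf_div.
rewrite ler_pdivlMl; last by rewrite divr_gt0.
apply: le_trans energy_ge.
have : 0 <= gamma / 2 * `|S (y k.+1)| ^+ 2.
  by rewrite mulr_ge0 ?sqr_ge0// ltW// divr_gt0.
have := sqr_ge0 `|tau^-1 *: fdiff z k|; have := sqr_ge0 `|tau^-1 *: fdiff y k|; lra.
Qed.

Lemma sqrt_le_energy2 : `|S (y k.+1)| ^+ 2 <= 2 / gamma * energy tau q z y k.
Proof.
have -> : 2 / gamma = (gamma / 2)^-1 by rewrite invf_div.
rewrite ler_pdivlMl; last by rewrite divr_gt0.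
apply: le_trans energy_ge.
have : 0 <= alpha / 2 * (`|S (z k.+1)| ^+ 2 + `|S (z k)| ^+ 2).
  by rewrite mulr_ge0 ?addr_ge0 ?sqr_ge0// ltW// divr_gt0.
have := sqr_ge0 `|tau^-1 *: fdiff z k|; have := sqr_ge0 `|tau^-1 *: fdiff y k|; lra.
Qed.

End one_step.

(** The sum of the two energy inequalities.  The change of weight contributes
    (q_{k+1} - q_k) / 2 times |S z_{k+1}|^2 + |S z_k|^2, which the previous energy
    controls; so does it control the forcing, which involves the errors at the
    middle layer only. *)
Lemma energy_step_le (tau alpha D b Kq : R) (q : nat -> R) (z y : nat -> H) (k : nat)
    (g1 g2 : H) :
  0 < tau -> 0 < alpha -> 0 <= Kq -> alpha <= q k -> alpha <= q k.+1 ->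
  (forall j, (j <= k.+2)%N -> dom A (z j) /\ dom A (y j)) ->
  (tau ^+ 2)^-1 *: fdiff (fdiff z) k + q k.+1 *: (2^-1 *: (A (z k.+2) + A (z k))) = g1 ->
  (tau ^+ 2)^-1 *: fdiff (fdiff y) k + 2^-1 *: (L (y k.+2) + L (y k)) = g2 ->
  `|g1| ^+ 2 <= D * tau ^+ 4 + b * (`|S (z k.+1)| ^+ 2 + `|S (y k.+1)| ^+ 2) ->
  `|g2| ^+ 2 <= D * tau ^+ 4 + b * (`|S (z k.+1)| ^+ 2 + `|S (y k.+1)| ^+ 2) ->
  0 <= D -> 0 <= b ->
  q k.+1 - q k <= tau * Kq ->
  energy tau q z y k.+1 <= energy tau q z y k +
    tau * (1 + 2 * D + 4 * b * (alpha^-1 + gamma^-1) + Kq / alpha) *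
      (energy tau q z y k.+1 + energy tau q z y k + tau ^+ 4).
Proof.
move=> tau0 al0 Kq0 qk qk1 Azy e1 e2 g1le g2le D0 b0 qq.
have [Az0 Ay0] := Azy k ltac:(by rewrite -addn2 leq_addr).
have [Az1 Ay1] := Azy k.+1 (leqnSn _).
have [Az2 Ay2] := Azy k.+2 (leqnn _).
have Azs : ip (A (z k.+2)) (z k) = ip (A (z k)) (z k.+2).
  by rewrite (self_adjoint_sym A_sa Az2 Az0) ipC.
have := three_layer_energy_le tau0 Azs e1; rewrite !(ip_sqrt ip_norm SA)// => E1.
have e2' : (tau ^+ 2)^-1 *: fdiff (fdiff y) k + 1 *: (2^-1 *: (L (y k.+2) + L (y k))) = g2.
  by rewrite scale1r.
have E2 := three_layer_energy_le tau0 (ip_Lop_sym Ay2 Ay0) e2'.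
have F0 := energy_ge0 tau z al0 qk Ay0 Ay1.
have F1 := energy_ge0 tau z al0 qk1 Ay1 Ay2.
have G0 := energy_ge tau z qk Ay0 Ay1.
have G1 := energy_ge tau z qk1 Ay1 Ay2.
have S1 := sqrt_le_energy tau z al0 qk Ay0 Ay1.
have S2 := sqrt_le_energy2 tau z al0 qk Ay0 Ay1.
set Ek := energy tau q z y k in F0 G0 S1 S2 *.
set Ek1 := energy tau q z y k.+1 in F1 G1 *.
set s1 := `|S (z k.+1)| ^+ 2 in E1 g1le g2le G0 G1 S1 S2 *.
set s0 := `|S (z k)| ^+ 2 in E1 G0 S1 *.
set r1 := `|S (y k.+1)| ^+ 2 in E1 E2 g1le g2le G0 S2 *.
have s00 : 0 <= s0 by exact: sqr_ge0.
have s10 : 0 <= s1 by exact: sqr_ge0.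
have r10 : 0 <= r1 by exact: sqr_ge0.
have t4 : 0 <= tau ^+ 4 by rewrite exprn_even_ge0.
(* the weight q_{k+1} is exchanged for q_k on the two layers of the earlier
   energy *)
have tel : Ek1 <= Ek + (q k.+1 - q k) / 2 * (s1 + s0) +
    tau * (`|g1| ^+ 2 + `|g2| ^+ 2 + (Ek1 + Ek) / 2).
  have w1 : `|tau^-1 *: fdiff z k.+1| ^+ 2 + `|tau^-1 *: fdiff y k.+1| ^+ 2 <= Ek1.
    apply: le_trans G1; rewrite -addrA lerDl addr_ge0// mulr_ge0 ?addr_ge0 ?sqr_ge0//;
      by rewrite ltW// divr_gt0.
  have w0 : `|tau^-1 *: fdiff z k| ^+ 2 + `|tau^-1 *: fdiff y k| ^+ 2 <= Ek.
    apply: le_trans G0; rewrite -addrA lerDl addr_ge0// mulr_ge0 ?addr_ge0 ?sqr_ge0//;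
      by rewrite ltW// divr_gt0.
  have w := ler_wpM2l (ltW tau0) (lerD w1 w0).
  rewrite -/(fdiff z k.+1) -/(fdiff z k) in E1.
  rewrite -/(fdiff y k.+1) -/(fdiff y k) in E2.
  have EkE : Ek = `|tau^-1 *: fdiff z k| ^+ 2 + q k / 2 * (s1 + s0) +
    (`|tau^-1 *: fdiff y k| ^+ 2 +
     2^-1 * (ip (L (y k.+1)) (y k.+1) + ip (L (y k)) (y k))) by [].
  have Ek1E : Ek1 = `|tau^-1 *: fdiff z k.+1| ^+ 2 + q k.+1 / 2 * (`|S (z k.+2)| ^+ 2 + s1) +
    (`|tau^-1 *: fdiff y k.+1| ^+ 2 +
     2^-1 * (ip (L (y k.+2)) (y k.+2) + ip (L (y k.+1)) (y k.+1))) by [].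
  lra.
have h1 : (q k.+1 - q k) / 2 * (s1 + s0) <= tau * (Kq / alpha) * Ek.
  apply: (@le_trans _ _ (tau * Kq / 2 * (2 / alpha * Ek))).
    apply: (@le_trans _ _ (tau * Kq / 2 * (s1 + s0))).
      by rewrite ler_wpM2r ?addr_ge0// ler_wpM2r.
    by rewrite ler_wpM2l// mulr_ge0// mulr_ge0// ltW.
  by rewrite le_eqVlt; apply/orP; left; apply/eqP; field; rewrite gt_eqF.
have h2 : `|g1| ^+ 2 + `|g2| ^+ 2 <=
    2 * D * tau ^+ 4 + 4 * b * (alpha^-1 + gamma^-1) * Ek.
  have : b * (s1 + r1) <= b * (2 / alpha * Ek + 2 / gamma * Ek).
    by rewrite ler_wpM2l// lerD//; apply: le_trans S1; rewrite lerDl.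
  lra.
have h3 := ler_wpM2l (ltW tau0) h2.
apply: (le_trans tel).
have ia : 0 <= Kq / alpha by rewrite divr_ge0// ltW.
have ib : 0 <= 4 * b * (alpha^-1 + gamma^-1).
  by rewrite mulr_ge0 ?mulr_ge0// addr_ge0// invr_ge0 ltW.
move: ia ib h1 h3; set X := Kq / alpha; set Y := 4 * b * _ => X0 Y0 h1 h3.
have t0 := ltW tau0.
have p1 : 0 <= tau * ((1 + 2 * D) * (Ek1 + Ek)).
  by apply: mulr_ge0 => //; apply: mulr_ge0; apply: addr_ge0 => //; apply: mulr_ge0.
have p2 : 0 <= tau * (D * (Ek1 + Ek)) by do 2?apply: mulr_ge0 => //; apply: addr_ge0.
have p3 : 0 <= tau * (X * (Ek1 + tau ^+ 4)) by do 2?apply: mulr_ge0 => //; apply: addr_ge0.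
have p4 : 0 <= tau * (Y * (Ek1 + tau ^+ 4)) by do 2?apply: mulr_ge0 => //; apply: addr_ge0.
have p5 : 0 <= tau * (Ek1 + Ek) by apply: mulr_ge0 => //; apply: addr_ge0.
have p6 : 0 <= tau * tau ^+ 4 by rewrite mulr_ge0.
lra.
Qed.

End energy.

(** The growth estimate is available only where E k <= (K0 + 1) tau^4.  On that
    range tau K <= 1/2 bounds E k.+1 a priori by (3 K0 + 4) tau^4, so each step
    adds at most tau P tau^4 with P = K (4 K0 + 6), and Tbar P <= 1 keeps the
    total below (K0 + 1) tau^4: the estimate propagates itself. *)
Lemma bootstrap_induction (R : realType) (E : nat -> R) (n : nat)
    (tau K K0 Tbar : R) :
  0 < tau -> 0 <= K -> 0 <= K0 ->
  (forall k, (k < n)%N -> 0 <= E k) ->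
  E 0 <= K0 * tau ^+ 4 ->
  (forall k, (k.+1 < n)%N -> E k <= (K0 + 1) * tau ^+ 4 ->
     E k.+1 <= E k + tau * K * (E k.+1 + E k + tau ^+ 4)) ->
  tau * K <= 2^-1 -> Tbar * (K * (4 * K0 + 6)) <= 1 ->
  forall k, (k < n)%N -> k%:R * tau <= Tbar -> E k <= (K0 + 1) * tau ^+ 4.
Proof.
move=> tau0 K_0 K00 E0 Einit step tK TK k kn kT.
set P := K * (4 * K0 + 6) in TK.
have P0 : 0 <= P by rewrite mulr_ge0//; lra.
have t4 : 0 <= tau ^+ 4 by rewrite exprn_even_ge0.
have small j : (j%:R * tau <= Tbar) -> j%:R * tau * P <= 1.
  by move=> jT; apply: le_trans TK; rewrite ler_wpM2r.
suff : E k <= (K0 + k%:R * tau * P) * tau ^+ 4.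
  by move=> /le_trans; apply; rewrite ler_wpM2r// lerD2l small.
elim: k kn kT => [|k IH] kn kT; first by rewrite !mul0r addr0.
have kT' : k%:R * tau <= Tbar.
  by apply: le_trans kT; rewrite ler_wpM2r ?ler_nat// ltW.
have {}IH := IH (ltnW kn) kT'.
have Ek1 : E k <= (K0 + 1) * tau ^+ 4.
  by apply: (le_trans IH); rewrite ler_wpM2r// lerD2l small.
have st := step k kn Ek1.
have y0 := E0 k (ltnW kn); have x0 := E0 k.+1 kn.
have s0 : 0 <= E k.+1 + E k + tau ^+ 4 by rewrite !addr_ge0.
have h1 := ler_wpM2r s0 tK.
have h2 : E k.+1 + E k + tau ^+ 4 <= (4 * K0 + 6) * tau ^+ 4 by lra.
have h3 : tau * K * (E k.+1 + E k + tau ^+ 4) <= tau * P * tau ^+ 4.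
  have tK0 : 0 <= tau * K by rewrite mulr_ge0// ltW.
  by have := ler_wpM2l tK0 h2; rewrite /P; lra.
rewrite -natr1; lra.
Qed.

(** * Regularity of the exact solution *)
Section regularity.
Context (R : realType) (H : completeNormedModType R) (ip : {dot H for (@idfun R)}).
Context (ip_norm : induces_norm ip) (T : R) (T_gt0 : 0 < T).
Context (A S : unbounded_operator H).
Context (A_sa : self_adjoint ip A) (SA : is_sqrt_op ip A S).
Local Notation I := (`[0, T]%classic : set R).
Local Notation D := (deriv_within I).

(** The properties of a component of the exact solution that the error analysis
    uses, all with one constant [M]; [w1], [w2], [w3] are its derivatives. *)
Record regular_path (M : R) (w w1 w2 w3 : R -> H) : Prop := RegularPath {
  path_deriv1 : has_deriv_on I w w1;
  path_deriv2 : has_deriv_on I w1 w2;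
  path_deriv3 : has_deriv_on I w2 w3;
  path_lip1 : lipschitz_on_seg T M w1;
  path_lip2 : lipschitz_on_seg T M w2;
  path_lip3 : lipschitz_on_seg T M w3;
  path_dom : forall t, I t -> dom A (w t);
  path_dom1 : forall t, I t -> dom A (w1 t);
  path_dom2 : forall t, I t -> dom A (w2 t);
  path_opderiv : has_deriv_on I (fun t => A (w t)) (fun t => A (w1 t));
  path_oplip : lipschitz_on_seg T M (fun t => A (w1 t));
  path_opbound : forall t, I t -> `|A (w t)| <= M;
  path_sqrtbound : forall t, I t -> `|S (w t)| <= M;
  path_sqrtlip : lipschitz_on_seg T M (fun t => S (w t)) }.

Lemma regular_path_weaken M M' w w1 w2 w3 : M <= M' ->
  regular_path M w w1 w2 w3 -> regular_path M' w w1 w2 w3.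
Proof.
move=> MM [? ? ? l1 l2 l3 ? ? ? ? l4 b1 b2 l5].
by split => //; try (by apply: lipschitz_on_seg_weaken MM _);
  move=> t It; apply: le_trans MM; [exact: b1|exact: b2].
Qed.

(** |S x|^2 = (A x, x) <= |A x| |x| for the increment x = w s - w t. *)
Lemma sqrt_lipschitz (M M' : R) (w : R -> H) : 0 <= M -> 0 <= M' ->
  (forall t, I t -> dom A (w t)) -> lipschitz_on_seg T M w ->
  lipschitz_on_seg T M' (fun t => A (w t)) ->
  lipschitz_on_seg T (M + M') (fun t => S (w t)).
Proof.
move=> M0 M0' Aw hM hM' s t Is It.
have As := Aw s Is; have At := Aw t It.
rewrite -opfunB; [|exact: dom_sqrt SA _ As|exact: dom_sqrt SA _ At].
rewrite -ler_sqr ?nnegrE ?mulr_ge0 ?addr_ge0//.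
apply: (le_trans (norm_sqrt_le ip_norm SA (domB As At))); rewrite opfunB//.
apply: (@le_trans _ _ ((M' * `|s - t|) * (M * `|s - t|))).
  by rewrite ler_pM// ?hM ?hM'.
have -> : M' * `|s - t| * (M * `|s - t|) = (M' * M) * `|s - t| ^+ 2 by ring.
rewrite exprMn ler_wpM2r ?sqr_ge0//.
by have := mulr_ge0 M0 M0'; have := sqr_ge0 M; have := sqr_ge0 M'; lra.
Qed.

(** On a bounded segment a Lipschitz function is bounded, and a function with
    bounded derivative is Lipschitz; this descends from w''' to w, and from A w'
    to A w and to S w. *)
Lemma regular_path_exists (w : R -> H) :
  continuously_derivable_within I 3 w ->
  [lipschitz nderiv_within I 3 w t | t in I] ->
  (forall t, I t -> dom A (w t)) ->
  continuously_derivable_within I 1 (fun t => A (w t)) ->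
  [lipschitz A (D w t) | t in I] ->
  exists2 M, 0 <= M & regular_path M w (D w) (D (D w)) (D (D (D w))).
Proof.
move=> [dw _] lw Aw [dAw _] lAw.
have d1 := deriv_withinP (dw 0 isT).
have d2 := deriv_withinP (dw 1 isT).
have d3 := deriv_withinP (dw 2 isT).
have dA := deriv_withinP (dAw 0 isT).
rewrite /nderiv_within /= in d1 d2 d3 dA.
have [M3 M30 l3] := lipschitz_on_segP lw; rewrite /nderiv_within /= in l3.
have [K3 K30 b3] := lipschitz_seg_bounded T_gt0 M30 l3.
have l2 := deriv_bounded_lipschitz ip_norm d3 b3.
have [K2 K20 b2] := lipschitz_seg_bounded T_gt0 K30 l2.
have l1 := deriv_bounded_lipschitz ip_norm d2 b2.
have [K1 K10 b1] := lipschitz_seg_bounded T_gt0 K20 l1.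
have l0 := deriv_bounded_lipschitz ip_norm d1 b1.
have Aw1 := self_adjoint_deriv ip_norm A_sa T_gt0 d1 dA Aw.
have dAw1 : has_deriv_on I (fun t => A (w t)) (fun t => A (D w t)).
  by apply: has_deriv_on_ext dA => // t It; rewrite (Aw1 t It).2.
have [N1 N10 lA1] := lipschitz_on_segP lAw.
have [N0 N00 bA1] := lipschitz_seg_bounded T_gt0 N10 lA1.
have lA := deriv_bounded_lipschitz ip_norm dAw1 bA1.
have [N N_0 bA] := lipschitz_seg_bounded T_gt0 N00 lA.
have lS := sqrt_lipschitz K10 N00 Aw l0 lA.
have [Q Q0 bS] := lipschitz_seg_bounded T_gt0 (addr_ge0 K10 N00) lS.
have Aw2 : forall t, I t -> dom A (D (D w) t).
  by apply: (dom_deriv_of_lipschitz ip_norm A_sa T_gt0 d2 _ lA1) => t /Aw1[].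
exists (M3 + K3 + K2 + K1 + N1 + N0 + N + Q); first by rewrite !addr_ge0.
split => //.
- by apply: lipschitz_on_seg_weaken l1; lra.
- by apply: lipschitz_on_seg_weaken l2; lra.
- by apply: lipschitz_on_seg_weaken l3; lra.
- by move=> t /Aw1[].
- by apply: lipschitz_on_seg_weaken lA1; lra.
- by move=> t It; apply: (le_trans (bA t It)); lra.
- by move=> t It; apply: (le_trans (bS t It)); lra.
- by apply: lipschitz_on_seg_weaken lS; lra.
Qed.

Section path_estimates.
Context (M : R) (M_ge0 : 0 <= M) (w w1 w2 w3 : R -> H).
Context (rw : regular_path M w w1 w2 w3).

Section interior.
Context (t h : R) (It : I t) (Ip : I (t + h)) (Im : I (t - h)).

Lemma path_second_difference_le : h != 0 ->
  `|(h ^+ 2)^-1 *: (w (t + h) - w t - (w t - w (t - h))) - w2 t| <= 2 * M * h ^+ 2.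
Proof.
move=> h0; have h20 : 0 < h ^+ 2 by rewrite exprn_even_gt0.
have := second_difference3_le ip_norm M_ge0 (path_deriv1 rw) (path_deriv2 rw)
  (path_deriv3 rw) (path_lip3 rw) It Ip Im.
set x := (X in `|X| <= _) => hx.
have -> : (h ^+ 2)^-1 *: (w (t + h) - w t - (w t - w (t - h))) - w2 t = (h ^+ 2)^-1 *: x.
  by apply: (ip_inj ip_norm) => e; rewrite /x !(ipZl, ipBl, ipDl); field.
rewrite normrZ gtr0_norm ?invr_gt0// ler_pdivrMl//.
by apply: (le_trans hx); rewrite le_eqVlt; apply/orP; left; apply/eqP; ring.
Qed.

Lemma average_le (x x1 : R -> H) : has_deriv_on I x x1 -> lipschitz_on_seg T M x1 ->
  `|2^-1 *: (x (t + h) + x (t - h)) - x t| <= M * h ^+ 2.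
Proof.
move=> hx lx; have := second_difference1_le ip_norm M_ge0 hx lx It Ip Im.
set y := (X in `|X| <= _) => hy.
have -> : 2^-1 *: (x (t + h) + x (t - h)) - x t = 2^-1 *: y.
  by apply: (ip_inj ip_norm) => e; rewrite /y !(ipZl, ipBl, ipDl); field.
by rewrite normrZ gtr0_norm// ler_pdivrMl// mulrA.
Qed.

End interior.

(** The first layer is a Taylor polynomial of degree 2.  Under A it is accurate to
    order 2 only, as A w'' need not be continuous, but the interpolation
    |S z|^2 <= |A z| |z| still leaves order 5 for the square. *)
Lemma path_initial_error_le : exists2 K, 0 <= K & forall tau, I tau ->
  let z := w tau - (w 0 + tau *: w1 0 + (tau ^+ 2 / 2) *: w2 0) in
  `|z| <= K * tau ^+ 3 /\ `|S z| ^+ 2 <= K * tau ^+ 5.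
Proof.
have I0 : I 0 by apply/segmentP; rewrite lexx ltW.
have N0 := normr_ge0 (A (w2 0)).
exists (M + (M + `|A (w2 0)|) * M) => [|tau Itau /=].
  by rewrite addr_ge0// mulr_ge0// addr_ge0.
have /segmentP/andP[tau0 _] := Itau.
have := taylor2_le ip_norm M_ge0 (path_deriv1 rw) (path_deriv2 rw) (path_lip2 rw) Itau I0.
rewrite subr0 ger0_norm//; set z := (X in `|X| <= _) => hz.
have hA := taylor1_le ip_norm M_ge0 (path_opderiv rw) (path_oplip rw) Itau I0.
rewrite subr0 ger0_norm// in hA.
have A0 := path_dom rw I0; have A1 := path_dom1 rw I0; have A2 := path_dom2 rw I0.
have At := path_dom rw Itau.
have A01 := domD A0 (domZ tau A1).
have A22 := domZ (tau ^+ 2 / 2) A2.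
have Az : dom A z by apply: domB => //; exact: domD.
have AzE : A z = A (w tau) - A (w 0) - tau *: A (w1 0) - (tau ^+ 2 / 2) *: A (w2 0).
  rewrite /z opfunB//; last exact: domD.
  by rewrite !opfunD ?opfunZ//; [rewrite !opprD !addrA|exact: domZ].
have Azle : `|A z| <= (M + `|A (w2 0)|) * tau ^+ 2.
  rewrite AzE; apply: (le_trans (ler_normB _ _)).
  rewrite normrZ ger0_norm ?divr_ge0 ?sqr_ge0//.
  have := mulr_ge0 N0 (sqr_ge0 tau); lra.
split.
  apply: (le_trans hz); rewrite ler_wpM2r ?exprn_ge0// lerDl mulr_ge0// addr_ge0//.
apply: (le_trans (norm_sqrt_le ip_norm SA Az)).
apply: (@le_trans _ _ (((M + `|A (w2 0)|) * tau ^+ 2) * (M * tau ^+ 3))).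
  by rewrite ler_pM.
have := exprn_ge0 5 tau0; have := mulr_ge0 M_ge0 (exprn_ge0 5 tau0); lra.
Qed.

End path_estimates.
End regularity.

(** * Error of the scheme *)
Section convergence.
Context (R : realType) (H : completeNormedModType R) (ip : {dot H for (@idfun R)}).
Context (ip_norm : induces_norm ip) (T : R) (T_gt0 : 0 < T).
Context (alpha beta gamma delta a1 a2 cB : R).
Context (alpha_gt0 : 0 < alpha) (beta_gt0 : 0 < beta).
Context (gamma_gt0 : 0 < gamma) (delta_gt0 : 0 < delta) (cB_gt0 : 0 < cB).
Context (A S B : unbounded_operator H) (C : {linear H -> H}).
Context (A_sa : self_adjoint ip A) (SA : is_sqrt_op ip A S).
Context (C_sym : symmetric_operator ip C) (C_ge0 : forall x : H, 0 <= ip (C x) x).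
Context (domAB : dom A `<=` dom B).
Context (B_le : forall x, dom A x -> `|B x| ^+ 2 <= cB ^+ 2 * ip (A x) x).
Local Notation I := (`[0, T]%classic : set R).
Local Notation kc := (kirchhoff_coef alpha beta S).
Local Notation L := (Lop gamma delta A C).

Let cB_ge0 : 0 <= cB. Proof. exact: ltW. Qed.

Let beta_ge0 : 0 <= beta. Proof. exact: ltW. Qed.

Lemma kirchhoff_coef_diff_le x y : `|kc x - kc y| <= beta * (`|S x - S y| * (`|S x| + `|S y|)).
Proof.
rewrite /kirchhoff_coef.
have -> : alpha + beta * `|S x| ^+ 2 - (alpha + beta * `|S y| ^+ 2) =
  beta * ((`|S x| - `|S y|) * (`|S x| + `|S y|)) by ring.
rewrite normrM gtr0_norm// ler_wpM2l// normrM [X in _ * X <= _]ger0_norm ?addr_ge0//.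
by rewrite ler_wpM2r ?addr_ge0// ler_dist_dist.
Qed.

Lemma kirchhoff_coef_ge x : alpha <= kc x.
Proof. by rewrite lerDl mulr_ge0 ?sqr_ge0. Qed.

Context (f1 f2 : R -> H) (u u1 u2 u3 v v1 v2 v3 : R -> H) (M : R) (M_ge0 : 0 <= M).
Context (ru : regular_path T A S M u u1 u2 u3).
Context (rv : regular_path T A S M v v1 v2 v3).
Context (C_le : forall x, `|C x| <= M * `|x|).
Context (equ : forall t, I t -> u2 t + kc (u t) *: A (u t) + a1 *: B (v t) = f1 t).
Context (eqv : forall t, I t ->
  v2 t + gamma *: A (v t) + delta *: C (v t) + a2 *: B (u t) = f2 t).

(** D1 and D2 bound the consistency errors of the two equations, b1 the effect
   of the error in the Kirchhoff coefficient on the forcing, and Kq its rate of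
   change along the mesh; K is the resulting constant of the energy
   recursion. *)
Let D1 := 2 * M + (alpha + beta * M ^+ 2) * M.
Let D2 := 2 * M + gamma * M + delta * M * M.
Let b1 := beta * (1 + 2 * M) * M.
Let D := 3 * D1 ^+ 2 + 3 * D2 ^+ 2.
Let b2 := 3 * (b1 ^+ 2 + (a1 * cB) ^+ 2 + (a2 * cB) ^+ 2).
Let Kq := 2 * (beta * (1 + 2 * M)) + 2 * beta * M ^+ 2.
Let K := 1 + 2 * D + 4 * b2 * (alpha^-1 + gamma^-1) + Kq / alpha.

Let M2 : 0 <= 1 + 2 * M.
Proof. by have := M_ge0; lra. Qed.

Let D_ge0 : 0 <= D.
Proof. by apply: addr_ge0; apply: mulr_ge0 => //; exact: sqr_ge0. Qed.

Let b2_ge0 : 0 <= b2.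
Proof. by apply: mulr_ge0 => //; rewrite !addr_ge0 ?sqr_ge0. Qed.

Let Kq_ge0 : 0 <= Kq.
Proof. by apply: addr_ge0; do 2?apply: mulr_ge0 => //; exact: mulr_ge0. Qed.

Section scheme.
Context (n : nat) (uh vh : nat -> H) (n_gt1 : (1 < n)%N).
Context (sch : is_scheme T alpha beta gamma delta a1 a2 A S B C f1 f2
                 (u 0) (u1 0) (v 0) (v1 0) n uh vh).
Local Notation tau := (T / n%:R).
Local Notation t_ k := (k%:R * tau).

Let q k := kc (uh k).
Let z k := u (t_ k) - uh k.
Let y k := v (t_ k) - vh k.

Let I0 : I 0. Proof. by apply/segmentP; rewrite lexx ltW. Qed.

Lemma step_gt0 : 0 < tau.
Proof. by rewrite divr_gt0// ltr0n ltnW. Qed.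

Lemma mesh_in k : (k <= n)%N -> I (t_ k).
Proof.
move=> kn; apply/segmentP; rewrite mulr_ge0//=; last exact: ltW step_gt0.
rewrite mulrA ler_pdivrMr ?ltr0n; last exact: ltnW.
by rewrite mulrC ler_wpM2l ?ler_nat ?ltW.
Qed.

Lemma phi2E : phi2 alpha beta a1 A S B f1 (u 0) (v 0) = u2 0.
Proof. by rewrite /phi2 -equ// !addrK. Qed.

Lemma psi2E : psi2 gamma delta a2 A B C f2 (u 0) (v 0) = v2 0.
Proof. by rewrite /psi2 -eqv// addrK /Lop -(addrA (v2 0)) addrK. Qed.

(** Layer 1 is where u''(0) in D(A) is needed; for the later layers the scheme
    itself provides membership. *)
Lemma scheme_dom k : (k <= n)%N -> dom A (uh k) /\ dom A (vh k).
Proof.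
have [[uh0 vh0] uh1 vh1 st] := sch.
case: k => [|[|k]] kn.
- by rewrite uh0 vh0; split; [exact: path_dom ru _ _|exact: path_dom rv _ _].
- rewrite uh1 vh1 phi2E psi2E; split; apply: domD; try apply: domD; try apply: domZ.
  + exact: path_dom ru _ _.
  + exact: path_dom1 ru _ _.
  + exact: path_dom2 ru _ _.
  + exact: path_dom rv _ _.
  + exact: path_dom1 rv _ _.
  + exact: path_dom2 rv _ _.
- by have [] := st k.+1; first by rewrite kn.
Qed.

Lemma error_dom k : (k <= n)%N -> dom A (z k) /\ dom A (y k).
Proof.
move=> kn; have [Au Av] := scheme_dom kn.
by split; apply: domB => //; [exact: path_dom ru _ (mesh_in kn)|exact: path_dom rv _ (mesh_in kn)].
Qed.

Lemma error_opE k : (k <= n)%N ->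
  [/\ A (z k) = A (u (t_ k)) - A (uh k), A (y k) = A (v (t_ k)) - A (vh k),
      B (z k) = B (u (t_ k)) - B (uh k), B (y k) = B (v (t_ k)) - B (vh k) &
      S (z k) = S (u (t_ k)) - S (uh k)].
Proof.
move=> kn; have [Au Av] := scheme_dom kn.
have Au' := path_dom ru (mesh_in kn); have Av' := path_dom rv (mesh_in kn).
by rewrite /z /y !opfunB//; try (by apply: domAB); apply: (dom_sqrt SA).
Qed.

Lemma norm_B_error_le k : (k <= n)%N ->
  `|B (z k)| <= cB * `|S (z k)| /\ `|B (y k)| <= cB * `|S (y k)|.
Proof.
move=> kn; have [Az Ay] := error_dom kn.
have h x : dom A x -> `|B x| <= cB * `|S x|.
  move=> Ax; rewrite -ler_sqr ?nnegrE ?mulr_ge0//.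
  by rewrite exprMn -(ip_sqrt ip_norm SA)// B_le.
by split; apply: h.
Qed.

(** The factor |S z_k| <= 1 keeps the quadratic coefficient Lipschitz with a
    constant that does not depend on the discrete solution. *)
Lemma coef_error_le k : (k <= n)%N -> `|S (z k)| <= 1 ->
  `|q k - kc (u (t_ k))| <= beta * (1 + 2 * M) * `|S (z k)|.
Proof.
move=> kn z1; rewrite distrC; apply: (le_trans (kirchhoff_coef_diff_le _ _)).
have [_ _ _ _ Sz] := error_opE kn; rewrite -Sz -mulrA ler_wpM2l// mulrC ler_wpM2r//.
have Mb := path_sqrtbound ru (mesh_in kn).
have : `|S (uh k)| <= `|S (u (t_ k))| + `|S (z k)|.
  have -> : S (uh k) = S (u (t_ k)) - S (z k) by rewrite Sz opprB addrC subrK.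
  exact: ler_normB.
lra.
Qed.

(** Compare both coefficients with those of the exact solution, which is
    Lipschitz in time. *)
Lemma coef_step_le k : (k < n)%N -> `|S (z k)| <= tau -> `|S (z k.+1)| <= tau ->
  tau <= 1 ->
  q k.+1 - q k <= tau * (2 * (beta * (1 + 2 * M)) + 2 * beta * M ^+ 2).
Proof.
move=> kn zk zk1 tau1.
have t0 := step_gt0; have k1n := ltnW kn.
have b0 : 0 <= beta * (1 + 2 * M).
  by rewrite mulr_ge0 ?ltW//; have := M_ge0; lra.
have h1 := coef_error_le k1n (le_trans zk tau1).
have h2 := coef_error_le kn (le_trans zk1 tau1).
have h1' := ler_wpM2l b0 zk; have h2' := ler_wpM2l b0 zk1.
have h3 : kc (u (t_ k.+1)) - kc (u (t_ k)) <= beta * (M * tau * (2 * M)).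
  apply: (le_trans (ler_norm _)); apply: (le_trans (kirchhoff_coef_diff_le _ _)).
  rewrite ler_wpM2l// ler_pM ?addr_ge0//.
    apply: (le_trans (path_sqrtlip ru (mesh_in kn) (mesh_in k1n))).
    by rewrite -mulrBl -natrB// subSnn mul1r ger0_norm// ltW.
  have := path_sqrtbound ru (mesh_in kn); have := path_sqrtbound ru (mesh_in k1n); lra.
have := ler_norm (q k.+1 - kc (u (t_ k.+1))).
have := ler_norm (kc (u (t_ k)) - q k); rewrite distrC; lra.
Qed.

Section error_equations.
Context (k : nat) (kn : (k.+1 < n)%N).

Let t := t_ k.+1.
Let tp : t_ k.+2 = t + tau. Proof. by rewrite /t -[k.+2%:R]natr1 mulrDl mul1r. Qed.
Let tm : t_ k = t - tau. Proof. by rewrite /t -[k.+1%:R]natr1 mulrDl mul1r addrK. Qed.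
Let It : I t. Proof. exact: mesh_in (ltnW kn). Qed.
Let Ip : I (t + tau). Proof. by rewrite -tp; exact: mesh_in. Qed.
Let Im : I (t - tau). Proof. by rewrite -tm; apply: mesh_in; rewrite ltnW// ltnW. Qed.

Let tau_neq0 : tau != 0. Proof. by rewrite gt_eqF// step_gt0. Qed.

(** The forcing of the error equation has three parts: the consistency error with
    the exact coefficient, the coefficient error times the average of A u, and
    the coupling.  Placing the coefficient error on the exact solution, whose A u
    is bounded, leaves the operator term with the discrete coefficient. *)
Lemma error_equation1 : `|S (z k.+1)| <= 1 ->
  exists2 g, (tau ^+ 2)^-1 *: fdiff (fdiff z) k
      + q k.+1 *: (2^-1 *: (A (z k.+2) + A (z k))) = g &
    `|g| ^+ 2 <= 3 * D1 ^+ 2 * tau ^+ 4 + 3 * (b1 ^+ 2 * `|S (z k.+1)| ^+ 2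
       + (a1 * cB) ^+ 2 * `|S (y k.+1)| ^+ 2).
Proof.
move=> z1.
have [_ _ _ st] := sch; have [_ _ e1 _] := st k.+1 ltac:(by rewrite kn).
rewrite /= -equ// in e1.
have [Az2 _ _ _ _] := error_opE kn.
have [Az0 _ _ _ _] := error_opE (ltnW (ltnW kn)).
have [_ _ _ By _] := error_opE (ltnW kn).
set du := (tau ^+ 2)^-1 *: (u (t + tau) - u t - (u t - u (t - tau))) - u2 t.
set au := 2^-1 *: (A (u (t + tau)) + A (u (t - tau))).
have hdu := path_second_difference_le ip_norm M_ge0 ru It Ip Im tau_neq0.
have hau := average_le ip_norm M_ge0 It Ip Im (path_opderiv ru) (path_oplip ru).
rewrite -/du in hdu; rewrite -/au in hau.
pose Q := kc (u t).
exists ((du + Q *: (au - A (u t))) + (q k.+1 - Q) *: au + (- a1) *: B (y k.+1)).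
  have -> : fdiff (fdiff z) k =
     (u (t + tau) - u t - (u t - u (t - tau))) - fdiff (fdiff uh) k.
    apply: (ip_inj ip_norm) => e; rewrite /fdiff /z tp tm !(ipZl, ipBl, ipDl).
    by rewrite -/t; ring.
  rewrite Az2 Az0 By tp tm.
  apply: (ip_inj ip_norm) => e.
  have := congr1 (ip^~ e) e1.
  rewrite /du /au -/t -/(q k.+1) -/Q !(ipZl, ipBl, ipDl) => e1'; lra.
apply: (le_trans (sqr_norm_add3_le _ _ _)).
have t0 := step_gt0.
have sq (a b : R) : 0 <= a -> a <= b -> a ^+ 2 <= b ^+ 2.
  by move=> a0 ab; rewrite ler_sqr ?nnegrE// (le_trans a0).
have Q0 : 0 <= Q by exact: le_trans (ltW alpha_gt0) (kirchhoff_coef_ge _).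
have QM : Q <= alpha + beta * M ^+ 2.
  by rewrite lerD2l ler_wpM2l// sq// (path_sqrtbound ru).
have h1 : `|du + Q *: (au - A (u t))| ^+ 2 <= D1 ^+ 2 * tau ^+ 4.
  rewrite (_ : D1 ^+ 2 * tau ^+ 4 = (D1 * tau ^+ 2) ^+ 2); last by ring.
  apply: sq => //; apply: (le_trans (ler_normD _ _)); rewrite normrZ ger0_norm//.
  have : Q * `|au - A (u t)| <= (alpha + beta * M ^+ 2) * (M * tau ^+ 2).
    by rewrite ler_pM.
  rewrite /D1; lra.
have auM : `|au| <= M.
  rewrite normrZ gtr0_norm// ler_pdivrMl//; apply: (le_trans (ler_normD _ _)).
  by have := path_opbound ru Ip; have := path_opbound ru Im; lra.
have h2 : `|(q k.+1 - Q) *: au| ^+ 2 <= b1 ^+ 2 * `|S (z k.+1)| ^+ 2.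
  rewrite -exprMn; apply: sq => //; rewrite normrZ.
  rewrite (_ : b1 * `|S (z k.+1)| = beta * (1 + 2 * M) * `|S (z k.+1)| * M); last by rewrite /b1; ring.
  by rewrite ler_pM// coef_error_le// ltnW.
have h3 : `|- a1 *: B (y k.+1)| ^+ 2 <= (a1 * cB) ^+ 2 * `|S (y k.+1)| ^+ 2.
  rewrite normrZ normrN exprMn real_normK ?num_real// exprMn -[leRHS]mulrA -[X in _ <= _ * X]exprMn.
  apply: ler_wpM2l; [exact: sqr_ge0|apply: sq => //].
  by have [] := norm_B_error_le (ltnW kn).
lra.
Qed.

Lemma error_equation2 :
  exists2 g, (tau ^+ 2)^-1 *: fdiff (fdiff y) k
      + 2^-1 *: (L (y k.+2) + L (y k)) = g &
    `|g| ^+ 2 <= 3 * D2 ^+ 2 * tau ^+ 4 + 3 * ((a2 * cB) ^+ 2 * `|S (z k.+1)| ^+ 2).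
Proof.
have [_ _ _ st] := sch; have [_ _ _ e2] := st k.+1 ltac:(by rewrite kn).
rewrite /= -eqv// in e2.
have [_ Ay2 _ _ _] := error_opE kn.
have [_ Ay0 _ _ _] := error_opE (ltnW (ltnW kn)).
have [_ _ Bz _ _] := error_opE (ltnW kn).
set dv := (tau ^+ 2)^-1 *: (v (t + tau) - v t - (v t - v (t - tau))) - v2 t.
set av := 2^-1 *: (A (v (t + tau)) + A (v (t - tau))) - A (v t).
set cv := 2^-1 *: (v (t + tau) + v (t - tau)) - v t.
have hdv := path_second_difference_le ip_norm M_ge0 rv It Ip Im tau_neq0.
have hav := average_le ip_norm M_ge0 It Ip Im (path_opderiv rv) (path_oplip rv).
have hcv := average_le ip_norm M_ge0 It Ip Im (path_deriv1 rv) (path_lip1 rv).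
rewrite -/dv in hdv; rewrite -/av in hav; rewrite -/cv in hcv.
exists ((dv + gamma *: av + delta *: C cv) + 0 + (- a2) *: B (z k.+1)).
  have -> : fdiff (fdiff y) k =
     (v (t + tau) - v t - (v t - v (t - tau))) - fdiff (fdiff vh) k.
    apply: (ip_inj ip_norm) => e; rewrite /fdiff /y tp tm !(ipZl, ipBl, ipDl).
    by rewrite -/t; ring.
  have CB a b : C (a - b) = C a - C b by exact: raddfB.
  have CD a b : C (a + b) = C a + C b by exact: raddfD.
  have CZ a b : C (a *: b) = a *: C b by exact: linearZ.
  rewrite /Lop Ay2 Ay0 Bz /y tp tm /cv !(CB, CZ, CD).
  apply: (ip_inj ip_norm) => e.
  have := congr1 (ip^~ e) e2.
  rewrite /dv /av /Lop -/t !(ipZl, ipBl, ipDl, ip0l) => e2'; lra.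
apply: (le_trans (sqr_norm_add3_le _ _ _)).
have t0 := step_gt0.
have sq (a b : R) : 0 <= a -> a <= b -> a ^+ 2 <= b ^+ 2.
  by move=> a0 ab; rewrite ler_sqr ?nnegrE// (le_trans a0).
have h1 : `|dv + gamma *: av + delta *: C cv| ^+ 2 <= D2 ^+ 2 * tau ^+ 4.
  rewrite (_ : D2 ^+ 2 * tau ^+ 4 = (D2 * tau ^+ 2) ^+ 2); last by ring.
  apply: sq => //; apply: (le_trans (ler_normD _ _)).
  apply: (le_trans (lerD (ler_normD _ _) (lexx _))).
  rewrite !normrZ !gtr0_norm//.
  have := ler_wpM2l (ltW gamma_gt0) hav.
  have := ler_wpM2l (ltW delta_gt0) (le_trans (C_le cv) (ler_wpM2l M_ge0 hcv)).
  rewrite /D2; lra.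
have h3 : `|- a2 *: B (z k.+1)| ^+ 2 <= (a2 * cB) ^+ 2 * `|S (z k.+1)| ^+ 2.
  rewrite normrZ normrN exprMn real_normK ?num_real// exprMn -[leRHS]mulrA -[X in _ <= _ * X]exprMn.
  apply: ler_wpM2l; [exact: sqr_ge0|apply: sq => //].
  by have [] := norm_B_error_le (ltnW kn).
rewrite normr0 expr0n /=; lra.
Qed.

End error_equations.

Local Notation E := (energy ip A S C gamma delta tau q z y).

Lemma scheme_energy_step_le k : (k.+1 < n)%N ->
  `|S (z k)| <= tau -> `|S (z k.+1)| <= tau -> tau <= 1 ->
  E k.+1 <= E k + tau * K * (E k.+1 + E k + tau ^+ 4).
Proof.
move=> kn zk zk1 tau1.
have [g1 e1 h1] := error_equation1 kn (le_trans zk1 tau1).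
have [g2 e2 h2] := error_equation2 kn.
have t4 : 0 <= tau ^+ 4 by rewrite exprn_even_ge0.
have s2 (x : R) := sqr_ge0 x.
have sz := s2 `|S (z k.+1)|; have sy := s2 `|S (y k.+1)|.
apply: (energy_step_le ip_norm A_sa SA C_sym C_ge0 gamma_gt0 delta_gt0 step_gt0
  alpha_gt0 _ (kirchhoff_coef_ge _) (kirchhoff_coef_ge _) _ e1 e2 _ _ D_ge0 b2_ge0).
- exact: Kq_ge0.
- by move=> j jk; apply: error_dom; exact: leq_trans jk kn.
- apply: (le_trans h1); rewrite /D /b2.
  have := mulr_ge0 (s2 D2) t4.
  have := mulr_ge0 (s2 b1) sy.
  have := mulr_ge0 (s2 (a1 * cB)) sz.
  have := mulr_ge0 (s2 (a2 * cB)) sz.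
  have := mulr_ge0 (s2 (a2 * cB)) sy.
  move: (S (z k.+1)) (S (y k.+1)) => ? ?; lra.
- apply: (le_trans h2); rewrite /D /b2.
  have := mulr_ge0 (s2 D1) t4.
  have := mulr_ge0 (s2 b1) sy.
  have := mulr_ge0 (s2 b1) sz.
  have := mulr_ge0 (s2 (a1 * cB)) sz.
  have := mulr_ge0 (s2 (a1 * cB)) sy.
  have := mulr_ge0 (s2 (a2 * cB)) sy.
  move: (S (z k.+1)) (S (y k.+1)) => ? ?; lra.
- exact: coef_step_le (ltnW kn) zk zk1 tau1.
Qed.

Lemma scheme_energy_ge0 k : (k < n)%N -> 0 <= E k.
Proof.
move=> kn; have [_ Ay] := error_dom (ltnW kn); have [_ Ay'] := error_dom kn.
exact: (energy_ge0 ip_norm SA C_ge0 gamma_gt0 delta_gt0 tau z alpha_gt0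
  (kirchhoff_coef_ge _) Ay Ay').
Qed.

Lemma initial_energy_le (Ki : R) : 0 <= Ki -> tau <= 1 ->
  (forall t, I t -> let zt := u t - (u 0 + t *: u1 0 + (t ^+ 2 / 2) *: u2 0) in
    `|zt| <= Ki * t ^+ 3 /\ `|S zt| ^+ 2 <= Ki * t ^+ 5) ->
  (forall t, I t -> let yt := v t - (v 0 + t *: v1 0 + (t ^+ 2 / 2) *: v2 0) in
    `|yt| <= Ki * t ^+ 3 /\ `|S yt| ^+ 2 <= Ki * t ^+ 5) ->
  E 0 <= (2 * Ki ^+ 2 + (alpha + beta * M ^+ 2) * Ki + gamma * Ki + delta * M * Ki ^+ 2)
    * tau ^+ 4.
Proof.
move=> Ki0 tau1 hu hv; have t0 := step_gt0.
have [[uh0 vh0] uh1 vh1 _] := sch; rewrite phi2E in uh1; rewrite psi2E in vh1.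
have Itau : I tau by have := mesh_in (ltnW n_gt1); rewrite mul1r.
have z0 : z 0 = 0 by rewrite /z mul0r uh0 subrr.
have y0 : y 0 = 0 by rewrite /y mul0r vh0 subrr.
have z1E : z 1 = u tau - (u 0 + tau *: u1 0 + (tau ^+ 2 / 2) *: u2 0).
  by rewrite /z mul1r uh1.
have y1E : y 1 = v tau - (v 0 + tau *: v1 0 + (tau ^+ 2 / 2) *: v2 0).
  by rewrite /y mul1r vh1.
have [] := hu tau Itau; rewrite -z1E => nz Sz.
have [] := hv tau Itau; rewrite -y1E => ny Sy.
have [_ Ay] := error_dom (ltnW n_gt1).
have t4 : 0 <= tau ^+ 4 by rewrite exprn_even_ge0.
have t5 : Ki * tau ^+ 5 <= Ki * tau ^+ 4.
  by rewrite ler_wpM2l// exprSr ler_piMr.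
have tq : 0 <= Ki * tau ^+ 2 by exact: mulr_ge0 Ki0 (sqr_ge0 _).
have quot (x : H) : `|x| <= Ki * tau ^+ 3 -> `|tau^-1 *: x| ^+ 2 <= Ki ^+ 2 * tau ^+ 4.
  move=> hx; rewrite (_ : Ki ^+ 2 * tau ^+ 4 = (Ki * tau ^+ 2) ^+ 2); last by ring.
  rewrite ler_sqr ?nnegrE// normrZ gtr0_norm ?invr_gt0//.
  rewrite ler_pdivrMl//; apply: (le_trans hx).
  by rewrite le_eqVlt; apply/orP; left; apply/eqP; ring.
have q0 : 0 <= q 0 <= alpha + beta * M ^+ 2.
  rewrite (le_trans (ltW alpha_gt0) (kirchhoff_coef_ge _))/= lerD2l ler_wpM2l//.
  by rewrite ler_sqr ?nnegrE// uh0; exact: (path_sqrtbound ru I0).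
have S0 : S 0 = 0 by exact: opfun0.
have L1 : ip (L (y 1)) (y 1) <= gamma * (Ki * tau ^+ 4) + delta * (M * (Ki ^+ 2 * tau ^+ 4)).
  rewrite /Lop ipDl !ipZl (ip_sqrt ip_norm SA Ay) lerD//.
    by rewrite ler_wpM2l ?(le_trans Sy)// ltW.
  rewrite ler_wpM2l ?(ltW delta_gt0)//; apply: (le_trans (ip_le_norm ip_norm _ _)).
  apply: (@le_trans _ _ (M * `|y 1| * `|y 1|)); first by rewrite ler_wpM2r.
  rewrite -mulrA ler_wpM2l// -expr2 (_ : Ki ^+ 2 * tau ^+ 4 = (Ki * tau ^+ 2) ^+ 2); last by ring.
  rewrite ler_sqr ?nnegrE//; apply: (le_trans ny).
  by rewrite ler_wpM2l// exprSr ler_piMr ?sqr_ge0.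
rewrite /energy /fdiff z0 y0 !subr0 S0 normr0 expr0n /= addr0.
rewrite [ip _ 0]ipC ip0l addr0.
have := quot _ nz; have := quot _ ny.
have : q 0 / 2 * `|S (z 1)| ^+ 2 <= (alpha + beta * M ^+ 2) * (Ki * tau ^+ 4).
  move/andP: q0 => [q00 q0M]; apply: ler_pM; [by rewrite divr_ge0|exact: sqr_ge0|lra|exact: le_trans Sz t5].
have : 0 <= gamma * (Ki * tau ^+ 4) by rewrite !mulr_ge0// ltW.
have : 0 <= delta * (M * (Ki ^+ 2 * tau ^+ 4)) by rewrite !mulr_ge0 ?sqr_ge0// ltW.
lra.
Qed.

(** The hypothesis tau * (2 / alpha * (K0 + 1)) <= 1 turns the bound
    E k <= (K0 + 1) tau^4 into |S z| <= tau, hence makes the energy estimate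
    available at the next step. *)
Lemma scheme_energy_le (K0 Tbar : R) : 0 <= K0 -> E 0 <= K0 * tau ^+ 4 ->
  tau <= 1 -> tau * K <= 2^-1 -> tau * (2 / alpha * (K0 + 1)) <= 1 ->
  Tbar * (K * (4 * K0 + 6)) <= 1 ->
  forall k, (k < n)%N -> k%:R * tau <= Tbar -> E k <= (K0 + 1) * tau ^+ 4.
Proof.
move=> K00 E0 tau1 tauK tauP TK.
have t0 := step_gt0.
apply: (bootstrap_induction t0 _ K00 scheme_energy_ge0 E0 _ tauK TK).
  have ia : 0 <= alpha^-1 by rewrite invr_ge0 ltW.
  have ig : 0 <= gamma^-1 by rewrite invr_ge0 ltW.
  apply: addr_ge0; last exact: divr_ge0 Kq_ge0 (ltW alpha_gt0).
  apply: addr_ge0; last by apply: mulr_ge0; [exact: mulr_ge0|exact: addr_ge0].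
  by apply: addr_ge0 => //; exact: mulr_ge0.
move=> k kn Ek; have [_ Ay] := error_dom (ltnW (ltnW kn)); have [_ Ay'] := error_dom (ltnW kn).
have hS := sqrt_le_energy ip_norm SA C_ge0 gamma_gt0 delta_gt0 (q := q) tau z alpha_gt0
  (kirchhoff_coef_ge _) Ay Ay'.
have {}hS : `|S (z k.+1)| ^+ 2 + `|S (z k)| ^+ 2 <= tau ^+ 2.
  apply: (le_trans hS); apply: (@le_trans _ _ (2 / alpha * ((K0 + 1) * tau ^+ 4))).
    by rewrite ler_wpM2l ?divr_ge0// ltW.
  have h1 := ler_wpM2r (exprn_ge0 3 (ltW t0)) tauP.
  have h2 : tau ^+ 3 <= tau ^+ 2 by rewrite exprSr ler_piMr ?sqr_ge0.
  lra.
have sz := sqr_ge0 `|S (z k)|; have sz1 := sqr_ge0 `|S (z k.+1)|.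
by apply: scheme_energy_step_le => //;
  rewrite -ler_sqr ?nnegrE ?(ltW t0)//; apply: le_trans hS; rewrite ?lerDl ?lerDr.
Qed.

Lemma energy_error_le (K1 c : R) k : (k < n)%N -> 0 <= c ->
  K1 <= c ^+ 2 -> 2 / alpha * K1 <= c ^+ 2 -> 2 / gamma * K1 <= c ^+ 2 ->
  E k <= K1 * tau ^+ 4 ->
  [/\ `|S (z k.+1)| <= c * tau ^+ 2, `|S (y k.+1)| <= c * tau ^+ 2,
      `|tau^-1 *: fdiff z k| <= c * tau ^+ 2 & `|tau^-1 *: fdiff y k| <= c * tau ^+ 2].
Proof.
move=> kn c0 c1 ca cg Ek.
have [_ Ay] := error_dom (ltnW kn); have [_ Ay'] := error_dom kn.
have t4 : 0 <= tau ^+ 4 by rewrite exprn_even_ge0.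
have tq : 0 <= c * tau ^+ 2 by exact: mulr_ge0 c0 (sqr_ge0 _).
have fromsq x K2 : 0 <= x -> K2 <= c ^+ 2 -> x ^+ 2 <= K2 * tau ^+ 4 -> x <= c * tau ^+ 2.
  move=> x0 K2c hx; rewrite -ler_sqr ?nnegrE//; apply: (le_trans hx).
  rewrite (_ : (c * tau ^+ 2) ^+ 2 = c ^+ 2 * tau ^+ 4); last by ring.
  by rewrite ler_wpM2r.
have hz := sqrt_le_energy ip_norm SA C_ge0 gamma_gt0 delta_gt0 (q := q) tau z alpha_gt0
  (kirchhoff_coef_ge _) Ay Ay'.
have hy := sqrt_le_energy2 ip_norm SA C_ge0 gamma_gt0 delta_gt0 (q := q) tau z alpha_gt0
  (kirchhoff_coef_ge _) Ay Ay'.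
have hE := energy_ge ip_norm SA C_ge0 gamma_gt0 delta_gt0 (q := q) tau z
  (kirchhoff_coef_ge _) Ay Ay'.
have pa : 0 <= alpha / 2 * (`|S (z k.+1)| ^+ 2 + `|S (z k)| ^+ 2).
  by rewrite mulr_ge0 ?addr_ge0 ?sqr_ge0// divr_ge0// ltW.
have pg : 0 <= gamma / 2 * `|S (y k.+1)| ^+ 2.
  by rewrite mulr_ge0 ?sqr_ge0// divr_ge0// ltW.
split.
- apply: (fromsq _ _ _ ca) => //; rewrite -[leRHS]mulrA.
  apply: (@le_trans _ _ (2 / alpha * E k)).
    by apply: le_trans hz; rewrite lerDl sqr_ge0.
  by rewrite ler_wpM2l ?divr_ge0// ltW.
- apply: (fromsq _ _ _ cg) => //; rewrite -[leRHS]mulrA; apply: (le_trans hy).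
  by rewrite ler_wpM2l ?divr_ge0// ltW.
- apply: (fromsq _ _ _ c1) => //; apply: le_trans Ek.
  have := sqr_ge0 `|tau^-1 *: fdiff y k|; lra.
- apply: (fromsq _ _ _ c1) => //; apply: le_trans Ek.
  have := sqr_ge0 `|tau^-1 *: fdiff z k|; lra.
Qed.

End scheme.

(** [Tbar] <= 1 / N with N above every constant that must be beaten: those of the
    energy recursion and of the bootstrap.  A layer k >= 1 before [Tbar] forces
    tau <= Tbar, so each smallness condition on tau holds whenever there is
    anything to prove. *)
Lemma regular_scheme_convergence :
  exists Tbar : R, 0 < Tbar <= T /\ exists2 c : R, 0 < c &
  forall (n : nat) (uh vh : nat -> H), (1 < n)%N ->
    is_scheme T alpha beta gamma delta a1 a2 A S B C f1 f2
      (u 0) (u1 0) (v 0) (v1 0) n uh vh ->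
    let tau : R := T / n%:R in
    let z1 (k : nat) : H := u (k%:R * tau) - uh k in
    let z2 (k : nat) : H := v (k%:R * tau) - vh k in
    forall k, k.+1%:R * tau <= Tbar ->
    [/\ `|S (z1 k.+1)| <= c * tau ^+ 2, `|S (z2 k.+1)| <= c * tau ^+ 2,
        `|tau^-1 *: fdiff z1 k| <= c * tau ^+ 2 &
        `|tau^-1 *: fdiff z2 k| <= c * tau ^+ 2].
Proof.
have [Ku Ku0 hu] := path_initial_error_le ip_norm T_gt0 SA M_ge0 ru.
have [Kv Kv0 hv] := path_initial_error_le ip_norm T_gt0 SA M_ge0 rv.
pose Ki := Ku + Kv.
have Ki0 : 0 <= Ki by exact: addr_ge0.
pose K0 := 2 * Ki ^+ 2 + (alpha + beta * M ^+ 2) * Ki + gamma * Ki + delta * M * Ki ^+ 2.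
have K00 : 0 <= K0.
  have s2 := sqr_ge0; have a0 := ltW alpha_gt0; have g0 := ltW gamma_gt0.
  have d0 := ltW delta_gt0.
  apply: addr_ge0; last by apply: mulr_ge0; [exact: mulr_ge0|exact: s2].
  apply: addr_ge0; last exact: mulr_ge0.
  apply: addr_ge0; first by apply: mulr_ge0 => //; exact: s2.
  by apply: mulr_ge0 => //; apply: addr_ge0 => //; apply: mulr_ge0 => //; exact: s2.
pose P := 2 / alpha * (K0 + 1).
(* absolute values make N an upper bound without sign discussions *)
pose N := 1 + 2 * `|K| + `|K * (4 * K0 + 6)| + `|P|.
have N1 : 1 <= N by rewrite /N -!addrA lerDl !addr_ge0// mulr_ge0.
have N0 : 0 < N by exact: lt_le_trans N1.
exists (Num.min T N^-1); split; first by rewrite lt_min T_gt0 invr_gt0 N0 ge_min lexx.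
have ia : 0 <= 2 / alpha by rewrite divr_ge0// ltW.
have ig : 0 <= 2 / gamma by rewrite divr_ge0// ltW.
have K01 : 0 <= K0 + 1 by lra.
have Pa := mulr_ge0 ia K01; have Pg := mulr_ge0 ig K01.
pose c := 1 + (K0 + 1) + 2 / alpha * (K0 + 1) + 2 / gamma * (K0 + 1).
have c1 : 1 <= c by rewrite /c; lra.
have csq x : x <= c -> x <= c ^+ 2.
  by move=> xc; apply: (le_trans xc); rewrite expr2 ler_peMl// (le_trans _ c1).
exists c; first exact: lt_le_trans c1.
move=> n uh vh n1 sch tau z1 z2 k kT.
have t0 : 0 < tau by exact: step_gt0 n1.
have tauT : tau <= Num.min T N^-1.
  apply: le_trans kT; rewrite ler_peMl ?ler1n//; exact: ltW.
have kn : (k < n)%N.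
  have : k.+1%:R * tau <= n%:R * tau.
    have -> : n%:R * tau = T by rewrite /tau mulrC divfK// pnatr_eq0 -lt0n ltnW.
    by apply: (le_trans kT); rewrite ge_min lexx.
  by rewrite ler_pM2r// ler_nat.
have tauN : tau * N <= 1.
  by rewrite -ler_pdivlMr// mul1r (le_trans tauT)// ge_min lexx orbT.
have TN : Num.min T N^-1 * N <= 1.
  by rewrite -ler_pdivlMr// mul1r ge_min lexx orbT.
have Tb0 : 0 <= Num.min T N^-1 by rewrite le_min !ltW ?invr_gt0.
have part (s x : R) : 0 <= s -> s * N <= 1 -> x <= N -> s * x <= 1.
  by move=> s0 sN xN; apply: le_trans sN; rewrite ler_wpM2l.
have nK := ler_norm K; have nK' := ler_norm (K * (4 * K0 + 6)); have nP := ler_norm P.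
have pK := normr_ge0 K; have pK' := normr_ge0 (K * (4 * K0 + 6)); have pP := normr_ge0 P.
have E0 : energy ip A S C gamma delta tau (fun k => kc (uh k)) z1 z2 0 <= K0 * tau ^+ 4.
  apply: (initial_energy_le n1 sch Ki0) => [|t It|t It].
  - by rewrite -[leLHS]mulr1; apply: part (ltW t0) tauN _.
  - have /segmentP/andP[t_0 _] := It.
    have [h1 h2] := hu t It; split; [apply: (le_trans h1)|apply: (le_trans h2)];
      by rewrite ler_wpM2r ?exprn_ge0// lerDl.
  - have /segmentP/andP[t_0 _] := It.
    have [h1 h2] := hv t It; split; [apply: (le_trans h1)|apply: (le_trans h2)];
      by rewrite ler_wpM2r ?exprn_ge0// lerDr.
have kT' : k%:R * tau <= Num.min T N^-1.
  by apply: le_trans kT; rewrite ler_wpM2r ?ler_nat// ltW.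
have Ek := scheme_energy_le n1 sch K00 E0 _ _ _ _ kn kT'.
apply: (energy_error_le n1 sch kn (K1 := K0 + 1)); last apply: Ek.
- exact: le_trans c1.
- by apply: csq; rewrite /c; lra.
- by apply: csq; rewrite /c; lra.
- by apply: csq; rewrite /c; lra.
- by rewrite -[leLHS]mulr1; apply: part (ltW t0) tauN _.
- change (tau * K <= 2^-1).
  have : tau * (2 * K) <= 1 by apply: part (ltW t0) tauN _; rewrite /N; lra.
  by rewrite mulrCA -ler_pdivlMl// mulr1.
- by apply: part (ltW t0) tauN _; rewrite -/P /N; lra.
- by change (Num.min T N^-1 * (K * (4 * K0 + 6)) <= 1); apply: part Tb0 TN _; rewrite /N; lra.
Qed.

End convergence.

Theorem theorem6p1
  (R : realType) (H : completeNormedModType R) (ip : {dot H for (@idfun R)})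
  (ip_norm : induces_norm ip)
  (T alpha beta gamma delta a1 a2 nu cB : R)
  (T_gt0 : 0 < T)
  (alpha_gt0 : 0 < alpha) (beta_gt0 : 0 < beta)
  (gamma_gt0 : 0 < gamma) (delta_gt0 : 0 < delta)
  (A S B : unbounded_operator H) (C : {linear H -> H})
  (A_self_adjoint : self_adjoint ip A)
  (nu_gt0 : 0 < nu) (A_ge_nu : bounded_below_by ip nu A)
  (S_sqrt_A : is_sqrt_op ip A S)
  (C_bounded : bounded_operator C) (C_symmetric : symmetric_operator ip C)
  (C_ge0 : forall x : H, 0 <= ip (C x) x)
  (B_closed : closed_operator B) (domAB : dom A `<=` dom B)
  (cB_gt0 : 0 < cB)
  (B_le : forall x, dom A x -> `|B x| ^+ 2 <= cB ^+ 2 * ip (A x) x)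
  (f1 f2 : R -> H) (phi0 phi1 psi0 psi1 : H)
  (wp : well_posed T alpha beta gamma delta a1 a2 A S B C f1 f2
          phi0 phi1 psi0 psi1)
  (u v : R -> H)
  (sol : is_solution T alpha beta gamma delta a1 a2 A S B C f1 f2
           phi0 phi1 psi0 psi1 u v)
  (hyp_a :
    [/\ dom A phi0 /\ dom A psi0,
        [/\ dom S phi1, dom S psi1,
            dom S (phi2 alpha beta a1 A S B f1 phi0 psi0) &
            dom S (psi2 gamma delta a2 A B C f2 phi0 psi0)],
        {within `[0, T]%classic, continuous f1} /\ {within `[0, T]%classic, continuous f2},
        forall t, `[0, T]%classic t -> dom S (f1 t) /\ dom S (f2 t) &
        {within `[0, T]%classic, continuous (fun t => S (f1 t))} /\
        {within `[0, T]%classic, continuous (fun t => S (f2 t))}])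
  (hyp_b :
    [/\ continuously_derivable_within `[0, T]%classic 3 u,
        continuously_derivable_within `[0, T]%classic 3 v,
        [lipschitz nderiv_within `[0, T]%classic 3 u t | t in `[0, T]%classic] &
        [lipschitz nderiv_within `[0, T]%classic 3 v t | t in `[0, T]%classic]])
  (hyp_c :
    [/\ continuously_derivable_within `[0, T]%classic 1 (fun t => A (u t)),
        continuously_derivable_within `[0, T]%classic 1 (fun t => A (v t)),
        forall t, `[0, T]%classic t ->
          dom A (deriv_within `[0, T]%classic u t) /\
          dom A (deriv_within `[0, T]%classic v t),
        [lipschitz A (deriv_within `[0, T]%classic u t) | t in `[0, T]%classic] &
        [lipschitz A (deriv_within `[0, T]%classic v t) | t in `[0, T]%classic]]) :
  exists Tbar : R, (0 < Tbar <= T) /\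
  exists c1 c2 c1' c2' : R,
    [/\ 0 < c1, 0 < c2, 0 < c1' & 0 < c2'] /\
    forall (n : nat) (uh vh : nat -> H), (1 < n)%N ->
      is_scheme T alpha beta gamma delta a1 a2 A S B C f1 f2
        phi0 phi1 psi0 psi1 n uh vh ->
      let tau : R := T / n%:R in
      let m := Num.truncn (Tbar / tau) in
      let z1 (k : nat) : H := u (k%:R * tau) - uh k in
      let z2 (k : nat) : H := v (k%:R * tau) - vh k in
      [/\ \big[Num.max/0]_(1 <= k < m.+1) `|S (z1 k)| <= c1 * tau ^+ 2,
          \big[Num.max/0]_(1 <= k < m.+1) `|S (z2 k)| <= c2 * tau ^+ 2,
          \big[Num.max/0]_(1 <= k < m.+1) `|tau^-1 *: fdiff z1 k.-1|
            <= c1' * tau ^+ 2 &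
          \big[Num.max/0]_(1 <= k < m.+1) `|tau^-1 *: fdiff z2 k.-1|
            <= c2' * tau ^+ 2].
Proof.
have [[_ _] solA _ soleq [phi0E phi1E psi0E psi1E]] := sol.
have [cu cv lu lv] := hyp_b.
have [cAu cAv _ lAu lAv] := hyp_c.
have [M1 M10 ru] := regular_path_exists ip_norm T_gt0 A_self_adjoint S_sqrt_A
  cu lu (fun t It => (solA t It).1) cAu lAu.
have [M2 M20 rv] := regular_path_exists ip_norm T_gt0 A_self_adjoint S_sqrt_A
  cv lv (fun t It => (solA t It).2) cAv lAv.
have [M3 C_le] := C_bounded.
(* the bound of C may be negative when H is trivial *)
pose M := M1 + M2 + `|M3|.
have n3 := normr_ge0 M3.
have M0 : 0 <= M by rewrite !addr_ge0.
have M1M : M1 <= M by rewrite /M; lra.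
have ruM := regular_path_weaken M1M ru.
have M2M : M2 <= M by rewrite /M; lra.
have rvM := regular_path_weaken M2M rv.
have C_leM x : `|C x| <= M * `|x|.
  apply: (le_trans (C_le x)); rewrite ler_wpM2r//.
  by rewrite /M; have := ler_norm M3; lra.
rewrite -phi0E -psi0E -phi1E -psi1E.
have [Tbar [Tbar_bd [c c0 conv]]] := regular_scheme_convergence (a1 := a1) (a2 := a2)
  ip_norm T_gt0 alpha_gt0 beta_gt0
  gamma_gt0 delta_gt0 cB_gt0 A_self_adjoint S_sqrt_A C_symmetric C_ge0 domAB B_le
  M0 ruM rvM C_leM (fun t It => (soleq t It).1) (fun t It => (soleq t It).2).
exists Tbar; split=> //; exists c, c, c, c; split=> // n uh vh n1 sch tau m z1 z2.
have tau0 : 0 < tau by rewrite divr_gt0// ltr0n ltnW.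
have ct0 : 0 <= c * tau ^+ 2 by rewrite mulr_ge0 ?sqr_ge0// ltW.
have mesh k : (0 < k < m.+1)%N -> k%:R * tau <= Tbar.
  move=> /andP[k0]; rewrite ltnS => km.
  have Tt0 : 0 <= Tbar / tau by rewrite divr_ge0 ?ltW//; case/andP: Tbar_bd.
  by rewrite -ler_pdivlMr// -truncn_ge_nat.
have bound (F : nat -> R) : (forall k, k.+1%:R * tau <= Tbar -> F k.+1 <= c * tau ^+ 2) ->
    \big[Num.max/0]_(1 <= k < m.+1) F k <= c * tau ^+ 2.
  move=> hF; rewrite big_nat_cond; apply: bigmax_le => // -[//|k] /andP[km _].
  by apply: hF; exact: mesh.
by split; apply: bound => k /(conv n uh vh n1 sch)[].
Qed.
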